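(* Let $d\ge2$ and $\theta\in(0,1]$. Let $\mathcal X$ and $\mathcal Y$ be compact convex sets in $\mathbb R^d$ with nonempty interior. There exist a probability measure $\rho$ on $\mathcal X$ satisfying, for some $M>0$, $\rho(B_\eta(x))\le M\eta^{d-1+\theta}$ for every $x\in\mathbb R^d$ and $\eta>0$, a measure $\mu\in\mathcal P(\mathcal Y)$, and transport plans $(\gamma_i)_{i\in\mathbb N}$ in $\Pi(\rho,\mu)$, such that for any $q\in[1,+\infty)$ and $$\alpha>\frac{\theta}{q(1+\theta)},$$ it holds that $$\limsup_{i\to\infty}\frac{W_q(\gamma_{\rho\to\mu},\gamma_i)}{\left(\int\langle x,y\rangle\,d(\gamma_{\rho\to\mu}-\gamma_i)\right)^\alpha}=\infty,$$ where $\gamma_{\rho\to\mu}$ is the optimal plan between $\rho$ and $\mu$. Consequently the exponent $\frac{\theta}{q(1+\theta)}$ of the suboptimality gap is sharp in the following estimates, for compact convex $\mathcal X,\mathcal Y$ (i.e. they do not hold in general with that exponent replaced by a larger one and with finite constants independent of the varying plan and measures): (i) for $\rho_0\in\mathcal P(\mathcal X)$ with $\rho_0(B_\eta(x))\le M\eta^{d-1+\theta}$ for all $x\in\mathbb R^d,\eta>0$, and $\mu_0\in\mathcal P(\mathcal Y)$ with optimal plan $\gamma_0$: for all $\rho_1\in\mathcal P(\mathcal X)$, $\mu_1\in\mathcal P(\mathcal Y)$, $\gamma_1\in\Pi(\rho_1,\mu_1)$, $W_q(\gamma_0,\gamma_1)\le C\big(|\int\langle x,y\rangle\,d(\gamma_0-\gamma_1)|+R_{\mathcal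 Y}W_1(\rho_0,\rho_1)+R_{\mathcal X}W_1(\mu_0,\mu_1)\big)^{\frac{\theta}{q(1+\theta)}}$; (ii) for $r\in[1,\infty]$ and $\tilde\rho\in\mathcal P(\mathcal X)$ with $\tilde\rho(B_\eta(x))\le M\eta^{d-1+\theta}$ for all $x\in\mathbb R^d,\eta>0$: for all $\rho\in\mathcal P(\mathcal X)$, $\mu\in\mathcal P(\mathcal Y)$, all optimal plans $\gamma_{\rho\to\mu}$ between $\rho$ and $\mu$ and all $\gamma\in\Pi(\rho,\mu)$, $W_q(\gamma_{\rho\to\mu},\gamma)\le C_0\big(\int\|x-y\|^2d\gamma-W_2^2(\rho,\mu)\big)^{\frac{\theta}{q(1+\theta)}}+C_1W_r(\rho,\tilde\rho)^\nu$, where $\nu=\frac{r\theta}{q(r+\theta)}$ if $r<\infty$ and $\nu=\frac\theta q$ if $r=\infty$.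
   Context: $\mathcal P(E)$ is the set of Borel probability measures on $E$, and $B_\eta(x)$ is the open Euclidean ball. $R_{\mathcal X}=\sup_{x\in\mathcal X}\|x\|$, $R_{\mathcal Y}=\sup_{y\in\mathcal Y}\|y\|$. $\Pi(\rho,\mu)$ is the set of couplings (transport plans) of $\rho$ and $\mu$. Optimal plans are the minimisers of $\int\|x-y\|^2\,d\gamma(x,y)$ over $\gamma\in\Pi(\rho,\mu)$ (equivalently the maximisers of $\int\langle x,y\rangle\,d\gamma$); under the ball condition on the first marginal the optimal plan is unique (Brenier-McCann). For $r\in[1,\infty]$ and measures on $\mathbb R^d$, $W_r(\rho,\mu)=\min_{\gamma\in\Pi(\rho,\mu)}\|x-y\|_{L^r(\gamma)}$. For probability measures $\gamma_0,\gamma_1$ on $\mathbb R^d\times\mathbb R^d$, $W_q^q(\gamma_0,\gamma_1)=\inf_{\pi\in\Pi(\gamma_0,\gamma_1)}\int\|x_0-x_1\|^q+\|y_0-y_1\|^q\,d\pi(x_0,y_0,x_1,y_1)$. *)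

(* Defs.v *)
From HB Require Import structures.
From mathcomp Require Import all_boot all_order all_algebra.
From mathcomp Require Import all_classical all_reals all_analysis.
Import Order.TTheory GRing.Theory Num.Theory.
Import numFieldNormedType.Exports.

Set Implicit Arguments.
Unset Strict Implicit.
Unset Printing Implicit Defensive.

Local Open Scope classical_set_scope.
Local Open Scope ring_scope.

(* R^d with its Borel sigma-algebra. Products of this type carry the product
   sigma-algebra, which is the Borel one since R^d is second countable. *)
Notation borelRd R d := (g_sigma_algebraType (@open 'rV[R]_d)).

Section Euclidean.
Context {R : realType} {d : nat}.
Implicit Types (x y : 'rV[R]_d) (X : set 'rV[R]_d).

Definition dotp x y : R := \sum_(i < d) x ord0 i * y ord0 i.

(* The norm that the library puts on 'rV[R]_d is the sup norm (it induces the
   same topology), so the Euclidean one is defined here. *)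
Definition enorm x : R := Num.sqrt (dotp x x).

Definition eball x (eta : R) : set 'rV[R]_d := [set z | enorm (z - x) < eta].

Definition sup_enorm X : R := sup [set enorm x | x in X].

End Euclidean.

(* Measures are only compared on measurable sets: their values elsewhere are
   unspecified. *)
Definition coupling {R : realType} {d1 d2 : measure_display}
    {T1 : measurableType d1} {T2 : measurableType d2}
    (P1 : probability T1 R) (P2 : probability T2 R) :
    set (probability (T1 * T2)%type R) :=
  [set g | (forall A, measurable A -> g (A `*` [set: T2]) = P1 A) /\
           (forall B, measurable B -> g ([set: T1] `*` B) = P2 B)].

Section OptimalTransport.
Context {R : realType} {d : nat}.
Local Notation E := (borelRd R d).
Implicit Types (rho mu : probability E R) (g : probability (E * E)%type R).
Implicit Types (X : set 'rV[R]_d) (q r : R).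

Definition prob_on X : set (probability E R) := [set rho | rho X = 1%E].

Definition ball_condition (theta M : R) rho : Prop :=
  forall (x : 'rV[R]_d) (eta : R), 0 < eta ->
    (rho (eball x eta) <= (M * eta `^ (d%:R - 1 + theta))%:E)%E.

Definition quadratic_cost g : \bar R :=
  (\int[g]_z ((enorm (z.1 - z.2) ^+ 2)%:E))%E.

Definition optimal_plan rho mu : set (probability (E * E)%type R) :=
  [set g | coupling rho mu g /\
    forall g', coupling rho mu g' -> (quadratic_cost g <= quadratic_cost g')%E].

Definition unique_optimal_plan rho mu g : Prop :=
  optimal_plan rho mu g /\
  forall g', optimal_plan rho mu g' -> forall A, measurable A -> g' A = g A.

Definition correlation g : R := \int[g]_z dotp z.1 z.2.

Definition wasserstein (r : \bar R) rho mu : \bar R :=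
  ereal_inf [set Lnorm g r (fun z => (enorm (z.1 - z.2))%:E)
            | g in coupling rho mu].

Definition plan_wasserstein q (g0 g1 : probability (E * E)%type R) : \bar R :=
  ((ereal_inf [set \int[p]_z
      ((enorm (z.1.1 - z.2.1) `^ q + enorm (z.1.2 - z.2.2) `^ q)%:E)
    | p in coupling g0 g1]) `^ q^-1)%E.

(* In the two estimates below, alpha is the exponent of the suboptimality
   gap. *)

Definition estimate_varying_marginals (theta : R) (X Y : set 'rV[R]_d)
    (q alpha : R) : Prop :=
  forall (M : R) rho0 mu0 g0, 0 < M ->
    prob_on X rho0 -> ball_condition theta M rho0 -> prob_on Y mu0 ->
    optimal_plan rho0 mu0 g0 ->
  exists C : R, forall rho1 mu1 g1,
    prob_on X rho1 -> prob_on Y mu1 -> coupling rho1 mu1 g1 ->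
    (plan_wasserstein q g0 g1 <=
     C%:E * (`|correlation g0 - correlation g1|%:E
             + (sup_enorm Y)%:E * wasserstein 1 rho0 rho1
             + (sup_enorm X)%:E * wasserstein 1 mu0 mu1) `^ alpha)%E.

Definition nu (theta q : R) (r : \bar R) : R :=
  if r is r'%:E then r' * theta / (q * (r' + theta)) else theta / q.

Definition estimate_reference_measure (theta : R) (X Y : set 'rV[R]_d)
    (q : R) (r : \bar R) (alpha : R) : Prop :=
  forall (M : R) rho', 0 < M ->
    prob_on X rho' -> ball_condition theta M rho' ->
  exists C0 C1 : R, forall rho mu gopt g,
    prob_on X rho -> prob_on Y mu ->
    optimal_plan rho mu gopt -> coupling rho mu g ->
    (plan_wasserstein q gopt g <=
     C0%:E * (quadratic_cost g - wasserstein 2%:E rho mu ^+ 2) `^ alpha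
     + C1%:E * wasserstein r rho rho' `^ (nu theta q r))%E.

End OptimalTransport.

(* Main.v *)
Require Import Defs.
From HB Require Import structures.
From mathcomp Require Import all_boot all_order all_algebra.
From mathcomp Require Import all_classical all_reals all_analysis.
From mathcomp Require Import measurable_realfun ess_sup_inf lra ring.
Import Order.TTheory GRing.Theory Num.Theory.
Import numFieldNormedType.Exports.

(** Inside [X] place a cube with centre [c] and half side [r], inside [Y] a
segment [yc - b e, yc + b e] in the direction [e] of the first coordinate, and
write [v] for the first coordinate of [x - c]. The target [mu] has mass 1/2 at
each end of the segment. The potential [b |v|] shows that the optimal plan sends
[x] to the end indicated by the sign of [v], whatever the source [rho] is, as
long as [rho] does not charge [v = 0] and gives both sides mass 1/2.

Exchange the two destinations on the strip [0 < |v| <= t]. The resulting plan is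
still a coupling if the strip is balanced, and what it loses in correlation is
the integral of [2 b |v|] over the strip, at most [2 b t u] where [u] is the
mass of the strip. Take for [rho] the half sum of two product measures with
[rho (|v| <= t)] proportional to [t^theta] and the other coordinates uniform:
this is what the ball condition of exponent [d - 1 + theta] allows, and it makes
the loss of order [u^(1 + 1/theta)] ([exists_source], [correlation_gap_le]).

The exchange could be undone cheaply by moving mass across the hyperplane
[v = 0], so the two halves of [rho] are also put apart in the remaining
coordinates, of which there is at least one since [d >= 2]: one half lies in the
upper corner of the cube and the other in the lower corner ([wedge]). Then every
transport of the optimal plan to the exchanged one moves the mass [u] by a fixed
distance, either in [x] or in [y], and [W_q] is at least of order [u^(1/q)]
([plan_wasserstein_ge], [plan_distance]). Comparing the powers of [u] as [u]
tends to 0 gives the threshold [theta / (q (1 + theta))] ([plan_distance_gap]).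

Both estimates are contradicted by the same family, as its plans share their
marginals: the Wasserstein terms between marginals vanish, and the excess of
quadratic cost is twice the loss of correlation. *)

Set Implicit Arguments.
Unset Strict Implicit.
Unset Printing Implicit Defensive.

Local Open Scope classical_set_scope.
Local Open Scope ring_scope.

(** * Borel sets of R^d *)

Section BorelRd.
Context {R : realType} {d : nat}.
Local Notation E := (borelRd R d).

Lemma open_measurable_Rd (U : set 'rV[R]_d) : open U -> measurable (U : set E).
Proof. by move=> oU; exact: sub_sigma_algebra. Qed.

Lemma closed_measurable_Rd (F : set 'rV[R]_d) :
  closed F -> measurable (F : set E).
Proof.
move=> cF; rewrite -(setCK F); apply: measurableC.
by apply: open_measurable_Rd; exact: closed_openC.
Qed.

Lemma compact_measurable_Rd (K : set 'rV[R]_d) :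
  compact K -> measurable (K : set E).
Proof.
move=> cK; apply: closed_measurable_Rd; apply: compact_closed cK.
exact: (@norm_hausdorff R ('rV[R]_d : pseudoMetricNormedZmodType R)).
Qed.

Lemma measurable_point_Rd (y : 'rV[R]_d) : measurable ([set y] : set E).
Proof. by apply: compact_measurable_Rd; exact: compact_set1. Qed.

Lemma measurable_coord (i : 'I_d) :
  measurable_fun [set: E] (fun x : E => x ord0 i).
Proof.
apply: (measurability _ (RGenOpens.measurableE R)).
move=> _ [_ [a [b ->] <-]]; rewrite setTI; apply: open_measurable_Rd.
move: (@coord_continuous R 1 d ord0 i) => /continuousP; apply.
exact: interval_open.
Qed.

Lemma measurable_box (A : 'I_d -> set R) : (forall i, measurable (A i)) ->
  measurable ([set x | forall i, A i (x ord0 i)] : set E).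
Proof.
move=> mA.
rewrite [X in measurable X](_ : _ =
    \bigcap_(i in [set: 'I_d]) ((fun x : E => x ord0 i) @^-1` A i)); last first.
  by rewrite predeqE => t; split=> [h i _|h i]; [exact: h|exact: h _ Logic.I].
apply: fin_bigcap_measurable => // i _; rewrite -[X in measurable X]setTI.
exact: measurable_coord.
Qed.

End BorelRd.

Lemma measurable_near {R : realType} (z eta : R) :
  measurable [set v : R | `|v - z| < eta].
Proof.
rewrite (_ : mkset _ = ball z eta); first exact: measurable_ball.
by rewrite predeqE => v; rewrite /ball/= distrC.
Qed.

Lemma measurable_abs_le {R : realType} (t : R) :
  measurable [set v : R | `|v| <= t].
Proof.
rewrite (_ : mkset _ = `[- t, t]%classic)//.
by rewrite predeqE => v; rewrite /= in_itv/= ler_norml.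
Qed.

Section BorelRd.
Context {R : realType} {d : nat}.
Local Notation E := (borelRd R d).

(** The open boxes with rational centres and radii [1/(k+1)] form a countable
base of the topology, hence the preimage of an open set is a countable union of
finite intersections of preimages of intervals. *)
Lemma measurable_fun_Rd {disp} {T : measurableType disp} (f : T -> E) :
  (forall i, measurable_fun [set: T] (fun t => f t ord0 i)) ->
  measurable_fun [set: T] f.
Proof.
move=> mf.
have sE : @measurable _ E = <<s @open 'rV[R]_d >> by [].
refine (@measurability _ _ T E setT f _ sE _).
move=> _ [U oU <-]; rewrite setTI.
pose rad k : R := k.+1%:R^-1.
pose box (p : 'rV[rat]_d * nat) : set 'rV[R]_d :=
  [set x | forall i, `|x ord0 i - ratr (p.1 ord0 i)| < rad p.2].
pose F p : set T := if `[< box p `<=` U >] then f @^-1` box p else set0.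
rewrite (_ : _ @^-1` U = \bigcup_p F p).
  apply: countable_bigcupT_measurable => [|p]; first exact: countableP.
  rewrite /F; case: ifP => // _.
  rewrite (_ : _ @^-1` _ = \bigcap_(i in [set: 'I_d])
     ((fun t => f t ord0 i) @^-1`
       [set v | `|v - ratr (p.1 ord0 i)| < rad p.2])); last first.
    by rewrite predeqE => t; split=> [h i _|h i]; [exact: h|exact: h _ Logic.I].
  apply: fin_bigcap_measurable => // i _; rewrite -[X in measurable X]setTI.
  by apply: mf => //; exact: measurable_near.
rewrite predeqE => t; split => [/= Ut|[p _]]; last first.
  by rewrite /F; case: asboolP => // /[apply].
have /nbhs_ballP[e /= e0 eU] : nbhs (f t : 'rV[R]_d) U.
  exact: open_nbhs_nbhs.
have [k ke] : exists k, rad k < e / 2.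
  have e20 : 0 < e / 2 by rewrite divr_gt0.
  have [k _ ke] := near_infty_natSinv_lt (PosNum e20).
  by exists k; exact: ke (leqnn k).
have rk0 : 0 < rad k by rewrite invr_gt0.
have q_ex i : exists q : rat, `|f t ord0 i - ratr q| < rad k.
  have [z [fz [q _ qz]]] := @dense_rat R (ball (f t ord0 i) (rad k))
    (ex_intro _ _ (ballxx _ rk0)) (ball_open _ _).
  by exists q; move: fz; rewrite /ball/= -qz.
pose q := \row_i xchoose (q_ex i).
exists (q, k) => //; rewrite /F; case: asboolP => [_ i|nsub].
  by rewrite /q mxE; exact: (xchooseP (q_ex i)).
case: nsub => x xbox; apply: eU; split=> // i j.
rewrite (ord1 i) /ball/=.
rewrite (le_lt_trans (ler_distD (ratr (q ord0 j)) _ _))// (splitr e) ltrD//.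
  by rewrite (lt_trans _ ke)// /q mxE; exact: (xchooseP (q_ex j)).
by rewrite distrC (lt_trans (xbox j)).
Qed.

End BorelRd.

(** * The Euclidean norm *)

Section Euclidean.
Context {R : realType} {d : nat}.
Local Notation E := (borelRd R d).
Implicit Types x y : 'rV[R]_d.

Lemma dotp_ge0 x : 0 <= dotp x x.
Proof. by apply: sumr_ge0 => i _; rewrite -expr2 sqr_ge0. Qed.

Lemma enorm_ge0 x : 0 <= enorm x.
Proof. exact: sqrtr_ge0. Qed.

Lemma enorm0 : enorm (0 : 'rV[R]_d) = 0.
Proof.
by rewrite /enorm /dotp big1 ?sqrtr0// => i _; rewrite mxE mulr0.
Qed.

Lemma sqr_enorm x : enorm x ^+ 2 = dotp x x.
Proof. by rewrite sqr_sqrtr ?dotp_ge0. Qed.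

Lemma sqr_enormB x y :
  enorm (x - y) ^+ 2 = dotp x x + dotp y y - 2 * dotp x y.
Proof.
rewrite sqr_enorm /dotp mulr_sumr -big_split -sumrB; apply: eq_bigr => i _.
by rewrite !mxE /=; ring.
Qed.

Lemma ler_coord_enorm x i : `|x ord0 i| <= enorm x.
Proof.
rewrite -sqrtr_sqr ler_wsqrtr// /dotp (bigD1 i)//= -expr2 lerDl.
by apply: sumr_ge0 => j _; rewrite -expr2 sqr_ge0.
Qed.

Lemma dotp_le x y (K : R) :
  (forall i, `|x ord0 i| <= K) -> (forall i, `|y ord0 i| <= K) ->
  `|dotp x y| <= d%:R * (K * K).
Proof.
move=> xK yK; rewrite (le_trans (ler_norm_sum _ _ _))//.
apply: (@le_trans _ _ (\sum_(i < d) K * K)).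
  by apply: ler_sum => i _; rewrite normrM ler_pM.
by rewrite sumr_const card_ord mulr_natl.
Qed.

Context {disp} {T : measurableType disp}.
Implicit Types f g : T -> E.

Lemma measurable_dotp f g :
  measurable_fun [set: T] f -> measurable_fun [set: T] g ->
  measurable_fun [set: T] (fun t => dotp (f t) (g t)).
Proof.
move=> mf mg; apply: measurable_sum => i; apply: measurable_funM.
  exact: measurableT_comp (measurable_coord i) mf.
exact: measurableT_comp (measurable_coord i) mg.
Qed.

Lemma measurable_subRd f g :
  measurable_fun [set: T] f -> measurable_fun [set: T] g ->
  measurable_fun [set: T] (fun t => (f t - g t : 'rV[R]_d) : E).
Proof.
move=> mf mg; apply: measurable_fun_Rd => i.
rewrite [X in measurable_fun _ X](_ : _ =
    (fun t => f t ord0 i) \- (fun t => g t ord0 i)); last first.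
  by apply/funext => t; rewrite !mxE.
apply: measurable_funB; first exact: measurableT_comp (measurable_coord i) mf.
exact: measurableT_comp (measurable_coord i) mg.
Qed.

Lemma measurable_enormB f g :
  measurable_fun [set: T] f -> measurable_fun [set: T] g ->
  measurable_fun [set: T] (fun t => enorm (f t - g t)).
Proof.
move=> mf mg; have mfg := measurable_subRd mf mg.
apply: measurableT_comp (measurable_dotp mfg mfg).
by apply: continuous_measurable_fun; exact: sqrt_continuous.
Qed.

End Euclidean.

Lemma measurable_eball {R : realType} {d : nat} (x : 'rV[R]_d) eta :
  measurable (eball x eta : set (borelRd R d)).
Proof.
have mf : measurable_fun setT (fun z : borelRd R d => enorm (z - x)).
  by apply: measurable_enormB.
rewrite (_ : eball x eta =
    (fun z : borelRd R d => enorm (z - x)) @^-1` `]-oo, eta[).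
  by rewrite -[X in measurable X]setTI; exact: mf.
by rewrite predeqE => z; rewrite /eball/= in_itv.
Qed.

(** * Constructions of probability measures *)

Definition law {d1 d2} {T1 : measurableType d1} {T2 : measurableType d2}
    {R : realType} (P : probability T1 R) (f : T1 -> T2)
    (mf : measurable_fun [set: T1] f) : probability T2 R :=
  distribution P (mfun_Sub (mem_set mf)).

Lemma lawE {d1 d2} {T1 : measurableType d1} {T2 : measurableType d2}
    {R : realType} (P : probability T1 R) (f : T1 -> T2)
    (mf : measurable_fun [set: T1] f) A : law P mf A = P (f @^-1` A).
Proof. by []. Qed.

Section midpoint.
Context {disp} {T : measurableType disp} {R : realType}.
Variables P Q : probability T R.

Let half_ge0 : 0 <= 2^-1 :> R. Proof. by rewrite invr_ge0. Qed.

Definition midpoint : set T -> \bar R :=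
  mscale (NngNum half_ge0) (measure_add P Q).

HB.instance Definition _ := Measure.on midpoint.

Lemma midpointE A : midpoint A = (2^-1%:E * (P A + Q A))%E.
Proof. by rewrite -measure_addE. Qed.

Let midpoint_setT : midpoint setT = 1%E.
Proof.
by rewrite midpointE !probability_setT -EFinD -EFinM mulVf// pnatr_eq0.
Qed.

HB.instance Definition _ :=
  Measure_isProbability.Build _ _ _ midpoint midpoint_setT.

End midpoint.

Definition unif01 {R : realType} : probability (measurableTypeR R) R :=
  uniform_prob (@ltr01 R).

Lemma unif01E {R : realType} (A : set R) : measurable A ->
  unif01 A = lebesgue_measure (A `&` `[0, 1]%classic).
Proof.
move=> mA; rewrite /unif01/= /uniform_prob integral_uniform_pdf.
rewrite (eq_integral (fun=> 1%E)).
  by rewrite integral_cst ?mul1e//; exact: measurableI.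
move=> x; rewrite inE/= in_itv/= /uniform_pdf => -[_ ->].
by rewrite subr0 invr1.
Qed.

(** By induction on the dimension: a vector of R^(n+1) is its first coordinate
followed by a vector of R^n, and the Borel sigma-algebra of R^(n+1) is generated
by the coordinates. *)
Lemma exists_product_law {R : realType} n
    (P : 'I_n -> probability (measurableTypeR R) R) :
  exists nu : probability (borelRd R n) R,
    forall A : 'I_n -> set R, (forall i, measurable (A i)) ->
      nu [set x | forall i, A i (x ord0 i)] = (\prod_(i < n) P i (A i))%E.
Proof.
elim: n P => [|n IHn] P.
  exists (dirac (0 : borelRd R 0)) => A _.
  rewrite big_ord0 [X in _ X = _](_ : _ = setT) ?probability_setT//.
  by rewrite predeqE => x; split=> // _ [].
have [nu nuE] := IHn (fun i => P (lift ord0 i)).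
pose join (z : measurableTypeR R * borelRd R n) : borelRd R n.+1 :=
  \row_i (if unlift ord0 i is Some j then z.2 ord0 j else z.1).
have mjoin : measurable_fun setT join.
  apply: measurable_fun_Rd => i; rewrite /join.
  have [j ->|->] := unliftP ord0 i.
    rewrite [X in measurable_fun _ X](_ : _ =
        (fun x : borelRd R n => x ord0 j) \o snd).
      by apply: measurableT_comp (measurable_coord j) _.
    by apply/funext => z /=; rewrite mxE liftK.
  rewrite [X in measurable_fun _ X](_ : _ = fst)//.
  by apply/funext => z /=; rewrite mxE unlift_none.
exists (law (P ord0 \x nu)%E mjoin) => A mA.
rewrite lawE (_ : _ @^-1` _ =
    A ord0 `*` [set x : borelRd R n | forall i, A (lift ord0 i) (x ord0 i)]).
  rewrite big_ord_recl -nuE => [|i]; last exact: mA.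
  apply: product_measure1E; first exact: mA.
  exact: (measurable_box (fun i => mA (lift ord0 i))).
rewrite predeqE => -[u x]; split=> [/= h|[/= h0 h] i].
  split=> [|i]/=; first by have := h ord0; rewrite mxE unlift_none.
  by have := h (lift ord0 i); rewrite mxE liftK.
by rewrite mxE; case: unliftP => [j ->|->].
Qed.

(** * The source measure *)

(** After division by [u `^ p] this is [t `^ p + (1 - t) `^ p <= 1] for [t] in
[[0, 1]], true because each power lowers its base. *)
Lemma powR_superadd {R : realType} (p u w : R) : 1 <= p -> 0 <= w <= u ->
  (u - w) `^ p <= u `^ p - w `^ p.
Proof.
move=> p1 /andP[w0 wu].
have [u0|u0] := eqVneq u 0.
  have -> : w = 0 by apply/eqP; rewrite eq_le w0 -u0 wu.
  by rewrite u0 !subr0 powR0 ?subrr// gt_eqF// (lt_le_trans ltr01).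
have {}u0 : 0 < u by rewrite lt_neqAle eq_sym u0 (le_trans w0).
have key x : 0 <= x <= u -> x `^ p <= u `^ p * (x / u).
  move=> /andP[x0 xu].
  rewrite -[in leLHS](divfK (lt0r_neq0 u0) x) mulrC powRM ?(ltW u0)//; last first.
    by rewrite divr_ge0// ltW.
  rewrite ler_wpM2l ?powR_ge0//.
  have [->|xn0] := eqVneq x 0.
    by rewrite mul0r powR0// gt_eqF// (lt_le_trans ltr01).
  apply: ge1r_powR => //; rewrite divr_gt0//= ?ler_pdivrMr ?mul1r//.
  by rewrite lt_neqAle eq_sym xn0.
rewrite lerBrDr (le_trans (lerD (key (u - w) _) (key w _)))//.
- by rewrite subr_ge0 wu lerBlDr lerDl.
- by rewrite w0 wu.
- by rewrite -mulrDr -mulrDl subrK divff ?mulr1// lt0r_neq0.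
Qed.

(** The power [theta^-1] is super-additive, hence its inverse is Hoelder of
exponent [theta]. *)
Lemma root_holder {R : realType} (theta u w : R) : 0 < theta -> theta <= 1 ->
  0 <= u -> 0 <= w -> `|u - w| <= `|u `^ theta^-1 - w `^ theta^-1| `^ theta.
Proof.
move=> t0 t1; wlog wu : u w / w <= u => [hw|] u0 w0.
  have [wu|/ltW uw] := leP w u; first exact: hw.
  by rewrite distrC [X in _ <= X `^ _]distrC; apply: hw.
have p1 : 1 <= theta^-1 by rewrite invf_ge1.
have h := powR_superadd p1 (introT andP (conj w0 wu)).
rewrite ger0_norm ?subr_ge0//.
apply: (@le_trans _ _ (((u - w) `^ theta^-1) `^ theta)).
  by rewrite -powRrM mulVf ?gt_eqF// powRr1// subr_ge0.
apply: ge0_ler_powR; rewrite ?nnegrE ?powR_ge0 ?(ltW t0)//.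
by rewrite (le_trans h)// ler_norm.
Qed.

(** If the inverse of [f] is Hoelder of exponent [k], the preimage of a ball of
radius [eta] has diameter of order [eta `^ k], hence mass of that order. *)
Lemma law_ball_le {R : realType} (f : R -> R)
    (mf : measurable_fun [set: measurableTypeR R] f) (C k z eta : R) :
  0 <= C -> 0 < k -> 0 < eta ->
  (forall u w, 0 <= u <= 1 -> 0 <= w <= 1 ->
     `|u - w| <= C * `|f u - f w| `^ k) ->
  (law unif01 mf [set v | (`|v - z| < eta)%R] <=
   (2 * C * (2 * eta) `^ k)%:E)%E.
Proof.
move=> C0 k0 eta0 hf; rewrite lawE.
set B := _ @^-1` _.
have mB : measurable B.
  by rewrite -[X in measurable X]setTI; apply: mf => //; exact: measurable_near.
rewrite unif01E//.
have [[u0 [Bu0 u01]]|noB] := pselect (B `&` `[0, 1]%classic !=set0); last first.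
  rewrite (_ : _ `&` _ = set0) ?measure0.
    by rewrite lee_fin !mulr_ge0// powR_ge0.
  by apply/eqP/negPn/negP => /set0P.
set L := C * (2 * eta) `^ k.
have L0 : 0 <= L by rewrite mulr_ge0// powR_ge0.
apply: (@le_trans _ _ (lebesgue_measure `[u0 - L, u0 + L]%classic)); last first.
  rewrite lebesgue_measure_itv/= lte_fin; case: ifPn => _; rewrite lee_fin -/L.
    by rewrite /L; lra.
  by rewrite !mulr_ge0// powR_ge0.
apply: le_measure; rewrite ?inE//; first exact: measurableI.
move=> u [/= Bu]; rewrite !in_itv/= => u1.
move: u01; rewrite /= in_itv/= => u01.
have : `|u - u0| <= L.
  apply: (le_trans (hf _ _ u1 u01)); rewrite ler_wpM2l//.
  apply: ge0_ler_powR; rewrite ?nnegrE ?mulr_ge0// ltW//.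
  rewrite (le_lt_trans (ler_distD z _ _))// mulr_natl mulr2n ltrD//.
  by rewrite distrC.
by rewrite ler_norml; lra.
Qed.

(** The positive half-line in which the values [v] with [0 < `|v| <= t] have
been exchanged with their opposites. *)
Definition switch {R : realType} (t : R) : set R :=
  [set v | t < v \/ (- t <= v /\ v < 0)].

Lemma measurable_switch {R : realType} (t : R) : measurable (switch t).
Proof.
rewrite (_ : switch t = `]t, +oo[ `|` `[(- t), 0[).
  exact: measurableU.
rewrite predeqE => v; rewrite /switch/= !in_itv/= andbT.
by split=> [[->|[-> ->]]|[->|/andP[-> ->]]]; [left|right|left|right].
Qed.

(** For [s = 1] and [s = -1] these are two opposite corners of the cube of
centre [c] and half side [r]. Both come arbitrarily close to the hyperplane
[x_i0 = c_i0], yet they are at distance at least [r] from each other in every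
other coordinate. *)
Definition wedge {R : realType} {d : nat} (r : R) (c : 'rV[R]_d) (i0 : 'I_d)
    (s : R) : set 'rV[R]_d :=
  [set x | forall i, 0 < s * (x ord0 i - c ord0 i) <= r /\
     (i != i0 -> r / 2 <= s * (x ord0 i - c ord0 i))].

Section source.
Context {R : realType} {d : nat}.
Local Notation E := (borelRd R d).
Variables (theta r : R) (c : 'rV[R]_d) (i0 : 'I_d).
Hypotheses (theta_gt0 : 0 < theta) (theta_le1 : theta <= 1) (r_gt0 : 0 < r).

(* The coordinate i0 of a sample is the power theta^-1 of a uniform variable, so
that it is at most t with probability t^theta. *)
Let profile (i : 'I_d) (u : R) : R :=
  if i == i0 then u `^ theta^-1 else (1 + u) / 2.

Let expo (i : 'I_d) : R := if i == i0 then theta else 1.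

Let place (s : R) (i : 'I_d) (u : R) : R := c ord0 i + s * r * profile i u.

Let measurable_place s i :
  measurable_fun [set: measurableTypeR R] (place s i : _ -> measurableTypeR R).
Proof.
apply: measurable_funD => //; apply: measurable_funM => //.
rewrite /profile; case: (i == i0); first exact: measurable_powR.
by apply: measurable_funM => //; exact: measurable_funD.
Qed.

Let coord_law s i := law unif01 (measurable_place s i).

Let profile_holder i u w : 0 <= u <= 1 -> 0 <= w <= 1 ->
  `|u - w| <= 2 * `|profile i u - profile i w| `^ expo i.
Proof.
move=> /andP[u0 u1] /andP[w0 w1]; rewrite /profile /expo; case: ifP => _.
  rewrite (le_trans (root_holder theta_gt0 theta_le1 u0 w0))//.
  by rewrite ler_peMl ?powR_ge0// ler1n.
rewrite powRr1// (_ : (1 + u) / 2 - _ = (u - w) / 2); last by field.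
by rewrite normrM [`|2^-1|]ger0_norm ?invr_ge0// mulrC divfK.
Qed.

Let coord_law_ball s i z eta : `|s| = 1 -> 0 < eta ->
  (coord_law s i [set v | (`|v - z| < eta)%R] <=
   (4 * (2 / r) `^ expo i * eta `^ expo i)%:E)%E.
Proof.
move=> s1 eta0.
have e0 : 0 < expo i by rewrite /expo; case: ifP.
have C0 : 0 <= 2 * r^-1 `^ expo i by rewrite mulr_ge0// powR_ge0.
apply: (le_trans (law_ball_le (measurable_place s i) z C0 e0 eta0 _)).
  move=> u w u01 w01; rewrite /place opprD addrACA subrr add0r -mulrBr.
  rewrite normrM normrM s1 mul1r (gtr0_norm r_gt0) powRM ?(ltW r_gt0)//.
  rewrite mulrA -(mulrA 2) -powRM ?invr_ge0 ?(ltW r_gt0)//.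
  by rewrite mulVf ?gt_eqF// powR1 mulr1 profile_holder.
rewrite lee_fin !powRM ?invr_ge0 ?(ltW r_gt0) ?(ltW eta0)//.
by rewrite le_eqVlt; apply/orP; left; apply/eqP; ring.
Qed.

Let measurable_shift (a : R) (A : set R) : measurable A ->
  measurable [set v : R | A (v - a)].
Proof.
have mf : measurable_fun setT (fun v : R => v - a) by exact: measurable_funB.
by move=> mA; rewrite -[X in measurable X]setTI; exact: mf.
Qed.

Let product_law s : exists nu : probability E R,
  forall A : 'I_d -> set R, (forall i, measurable (A i)) ->
    nu [set x | forall i, A i (x ord0 i)] = (\prod_i coord_law s i (A i))%E.
Proof. exact: exists_product_law. Qed.

Let prod_le (a b : 'I_d -> \bar R) : (forall i, 0 <= a i <= b i)%E ->
  (\prod_i a i <= \prod_i b i)%E.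
Proof.
move=> ab; suff /andP[] : (0 <= \prod_i a i <= \prod_i b i)%E by [].
elim/big_rec2 : _ => [|i x y _ /andP[y0 yx]]; first by rewrite lee01 lexx.
have /andP[a0 ai] := ab i.
by rewrite mule_ge0//= lee_pmul.
Qed.

Let prod_EFin (a : 'I_d -> R) : (\prod_i (a i)%:E)%E = (\prod_i a i)%:E.
Proof. by elim/big_rec2 : _ => // i x y _ ->. Qed.

Let sum_expo : \sum_i expo i = d%:R - 1 + theta.
Proof.
rewrite (bigD1 i0)//= /expo eqxx addrC; congr (_ + _).
rewrite (eq_bigr (fun=> 1)) => [|i /negbTE->//].
rewrite sumr_const cardC1 card_ord; case: d i0 => [[]//|n _].
by rewrite -(natrB _ (ltn0Sn n)) subn1.
Qed.

Let M := \prod_i (4 * (2 / r) `^ expo i).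

Let M_gt0 : 0 < M.
Proof. by apply: prodr_gt0 => i _; rewrite mulr_gt0// powR_gt0// divr_gt0. Qed.

Let box_ball s (nu : probability E R) (x : 'rV[R]_d) (eta : R) :
  `|s| = 1 -> 0 < eta ->
  (forall A : 'I_d -> set R, (forall i, measurable (A i)) ->
    nu [set x | forall i, A i (x ord0 i)] = (\prod_i coord_law s i (A i))%E) ->
  (nu [set y | forall i, (`|y ord0 i - x ord0 i| < eta)%R] <=
   (M * eta `^ (d%:R - 1 + theta))%:E)%E.
Proof.
move=> s1 eta0 nuE.
rewrite (nuE (fun i => [set v | `|v - x ord0 i| < eta])) => [|i]; last first.
  exact: measurable_near.
rewrite (@le_trans _ _
    (\prod_i (4 * (2 / r) `^ expo i * eta `^ expo i)%:E)%E)//.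
  by apply: prod_le => i; rewrite measure_ge0/=; exact: coord_law_ball.
rewrite prod_EFin lee_fin big_split/= -/M -sum_expo.
rewrite (@big_morph _ _ (powR eta) 1 *%R 0 +%R) ?powRr0// => p q.
by rewrite powRD// (gt_eqF eta0) implybT.
Qed.

Let coord_law_full s i (A : set R) : measurable A ->
  (forall u, 0 < u <= 1 -> A (place s i u)) -> coord_law s i A = 1%E.
Proof.
move=> mA uA; apply/eqP; rewrite eq_le probability_le1// andTb.
rewrite /coord_law lawE unif01E; last first.
  by rewrite -[X in measurable X]setTI; exact: measurable_place.
rewrite (@le_trans _ _ (lebesgue_measure `]0%R, 1%R]%classic))//.
  by rewrite lebesgue_measure_itv/= lte_fin ltr01 sube0.
apply: le_measure; rewrite ?inE//.
  apply: measurableI => //; rewrite -[X in measurable X]setTI.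
  exact: measurable_place.
move=> u; rewrite /= !in_itv/= => /andP[u0 u1]; split; last by rewrite (ltW u0).
by apply: uA; rewrite u0.
Qed.

Let marginal s (nu : probability E R) (A : set R) : measurable A ->
  (forall A : 'I_d -> set R, (forall i, measurable (A i)) ->
    nu [set x | forall i, A i (x ord0 i)] = (\prod_i coord_law s i (A i))%E) ->
  nu [set x | A (x ord0 i0)] = coord_law s i0 A.
Proof.
move=> mA nuE.
pose B i := if i == i0 then A else setT.
rewrite [X in nu X](_ : _ = [set x : E | forall i, B i (x ord0 i)]); last first.
  rewrite predeqE => x; split=> [Ax i|/(_ i0)]; rewrite /B ?eqxx//=.
  by case: eqP => // ->.
rewrite nuE => [|i]; last by rewrite /B; case: ifP.
rewrite (bigD1 i0)//= {1}/B eqxx big1 ?mule1// => i /negbTE ii0.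
by rewrite /B ii0 probability_setT.
Qed.

Let coord_lawE s (A : set R) : measurable A ->
  coord_law s i0 [set v | A (v - c ord0 i0)] =
  lebesgue_measure ([set u | A (s * (r * u `^ theta^-1))] `&` `[0, 1]%classic).
Proof.
move=> mA; rewrite /coord_law lawE unif01E; last first.
  rewrite -[X in measurable X]setTI; apply: measurable_place => //.
  exact: measurable_shift.
congr (lebesgue_measure (_ `&` _)); rewrite predeqE => u.
by rewrite /place /profile /preimage/= eqxx addrAC subrr add0r mulrA.
Qed.

Let root_lt u w : 0 <= u -> 0 <= w ->
  (r * u `^ theta^-1 < r * w `^ theta^-1) = (u < w).
Proof.
move=> u0 w0; rewrite ltr_pM2l//; apply/idP/idP; last first.
  by move=> uw; apply: gt0_ltr_powR; rewrite ?nnegrE ?invr_gt0.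
apply: contraTT; rewrite -!leNgt => wu.
by apply: ge0_ler_powR; rewrite ?nnegrE// invr_ge0 ltW.
Qed.

Let switch_law_pos u : 0 <= u <= 1 ->
  coord_law 1 i0 [set v | switch (r * u `^ theta^-1) (v - c ord0 i0)] =
  (1 - u)%:E.
Proof.
move=> /andP[u0 u1]; rewrite coord_lawE; last exact: measurable_switch.
rewrite (_ : _ `&` _ = `]u, 1]%classic).
  rewrite lebesgue_measure_itv/= lte_fin EFinB; case: ltP => // u1'.
  by rewrite (@le_anti _ _ u 1) ?subee// u1.
rewrite predeqE => w; rewrite /switch/= !in_itv/= mul1r; split.
  move=> [h /andP[w0 w1]]; rewrite w1 andbT -root_lt//.
  case: h => // -[_]; rewrite ltNge mulr_ge0 ?powR_ge0//; exact: ltW.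
move=> /andP[uw w1]; have w0 := le_trans u0 (ltW uw).
by rewrite w0 w1; split=> //; left; rewrite root_lt.
Qed.

Let switch_law_neg u : 0 <= u <= 1 ->
  coord_law (-1) i0 [set v | switch (r * u `^ theta^-1) (v - c ord0 i0)] = u%:E.
Proof.
move=> /andP[u0 u1]; rewrite coord_lawE; last exact: measurable_switch.
rewrite (_ : _ `&` _ = `]0, u]%classic).
  rewrite lebesgue_measure_itv/= lte_fin sube0; case: ltP => // u0'.
  by rewrite (@le_anti _ _ u 0)// u0 u0'.
have t0 z : 0 <= r * z `^ theta^-1 by rewrite mulr_ge0 ?powR_ge0// ltW.
have r0 : r * 0 `^ theta^-1 = 0 by rewrite powR0 ?mulr0// invr_neq0// gt_eqF.
rewrite predeqE => w; rewrite /switch/= !in_itv/= mulN1r lerN2 oppr_lt0; split.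
  move=> [h /andP[w0 w1]]; case: h => [|[]].
    by rewrite ltNge (le_trans _ (t0 u))// oppr_le0.
  by rewrite leNgt root_lt// -leNgt => -> rw; rewrite -root_lt// r0 rw.
move=> /andP[w0 wu]; rewrite (ltW w0) (le_trans wu u1); split=> //; right.
by split; [rewrite leNgt root_lt ?(ltW w0)// -leNgt|rewrite -r0 root_lt// ltW].
Qed.

Let strip_law s u : `|s| = 1 -> 0 <= u <= 1 ->
  coord_law s i0
    [set v | [set w | (`|w| <= r * u `^ theta^-1)%R] (v - c ord0 i0)] = u%:E.
Proof.
move=> s1 /andP[u0 u1]; rewrite coord_lawE; last first.
  exact: measurable_abs_le.
rewrite (_ : _ `&` _ = `[0, u]%classic).
  rewrite lebesgue_measure_itv/= lte_fin sube0; case: ltP => // u0'.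
  by rewrite (@le_anti _ _ u 0)// u0 u0'.
rewrite predeqE => w; rewrite /= !in_itv/= normrM s1 mul1r.
rewrite ger0_norm ?mulr_ge0 ?powR_ge0 ?(ltW r_gt0)//; split.
  by move=> [h /andP[w0 w1]]; rewrite w0/= leNgt -root_lt// -leNgt.
move=> /andP[w0 wu]; rewrite w0 (le_trans wu u1); split=> //.
by rewrite leNgt root_lt// -leNgt.
Qed.

Let wedge_law s (nu : probability E R) : s * s = 1 ->
  (forall A : 'I_d -> set R, (forall i, measurable (A i)) ->
    nu [set x | forall i, A i (x ord0 i)] = (\prod_i coord_law s i (A i))%E) ->
  measurable (wedge r c i0 s : set E) /\ nu (wedge r c i0 s) = 1%E.
Proof.
move=> s1 nuE.
pose B i := [set v | 0 < s * (v - c ord0 i) <= r /\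
   (i != i0 -> r / 2 <= s * (v - c ord0 i))].
have mB i : measurable (B i).
  have mf : measurable_fun setT (fun v : R => s * (v - c ord0 i)).
    by apply: measurable_funM => //; exact: measurable_funB.
  rewrite (_ : B i = (fun v : R => s * (v - c ord0 i)) @^-1`
      (`]0, r]%classic `&` (if i == i0 then setT else `[r / 2, +oo[%classic))).
    rewrite -[X in measurable X]setTI; apply: mf => //.
    by apply: measurableI => //; case: ifP.
  rewrite predeqE => v; rewrite /B/= in_itv/=.
  case: (i == i0) => /=; split=> -[h1 h2]; split=> //; rewrite /= ?in_itv/= ?andbT.
    exact: h2.
  by move: h2; rewrite in_itv/= andbT.
split; first exact: (measurable_box mB).
rewrite (nuE B)// big1// => i _; apply: coord_law_full => // u /andP[u0 u1].
have sE : s * (place s i u - c ord0 i) = r * profile i u.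
  by rewrite /place addrAC subrr add0r !mulrA s1 mul1r.
rewrite /B/= sE /profile; have [_|ii0] := eqVneq i i0.
  split=> //; rewrite mulr_gt0 ?powR_gt0//= ler_piMr ?(ltW r_gt0)//.
  have /= := @ge0_ler_powR R theta^-1; rewrite invr_ge0 => /(_ (ltW theta_gt0)).
  by move=> /(_ u 1); rewrite powR1 !nnegrE; apply=> //; exact: ltW.
split=> [|_].
  by rewrite mulr_gt0/= ?ler_piMr ?(ltW r_gt0)//; lra.
by rewrite ler_pM2l//; lra.
Qed.

(** The half sum of the two product measures on the opposite corners. On the
positive corner [switch t] keeps mass [1 - u] and on the negative one it gains
mass [u], so its total mass does not depend on [u]. *)
Lemma exists_source : exists rho : probability E R,
  [/\ measurable (wedge r c i0 1 `|` wedge r c i0 (-1) : set E) /\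
      rho (wedge r c i0 1 `|` wedge r c i0 (-1)) = 1%E,
    exists M, 0 < M /\ ball_condition theta M rho &
    forall u, 0 <= u <= 1 -> let t := r * u `^ theta^-1 in
      rho [set x | switch t (x ord0 i0 - c ord0 i0)] = (2^-1)%:E /\
      rho [set x | (`|x ord0 i0 - c ord0 i0| <= t)%R] = u%:E].
Proof.
have [nup nupE] := product_law 1; have [nun nunE] := product_law (-1).
have [mWp Wp] := wedge_law (mulr1 1) nupE.
have [mWn Wn] := wedge_law (etrans (mulrNN 1 1) (mulr1 1)) nunE.
have s1 : `|1 : R| = 1 by rewrite normr1.
have sn1 : `|-1 : R| = 1 by rewrite normrN1.
exists (midpoint nup nun); split.
- have mW := measurableU _ _ mWp mWn; split=> //.
  apply/eqP; rewrite eq_le probability_le1//= midpointE.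
  rewrite -[leLHS](_ : 2^-1%:E * (1 + 1) = 1)%E; last first.
    by rewrite -EFinD -EFinM mulVf// pnatr_eq0.
  rewrite lee_pmul2l ?lte_fin ?invr_gt0//.
  apply: leeD; [rewrite -[leLHS]Wp|rewrite -[leLHS]Wn];
    apply: le_measure; rewrite ?inE//.
- exists M; split=> // x eta eta0.
  set b := (_)%:E.
  pose box : set E := [set y | forall i, (`|y ord0 i - x ord0 i| < eta)%R].
  have mbox : measurable box.
    apply: (measurable_box (A := fun i => [set v | `|v - x ord0 i| < eta])) => i.
    exact: measurable_near.
  rewrite (@le_trans _ _ (midpoint nup nun box))//.
    apply: le_measure; rewrite ?inE//; first exact: measurable_eball.
    move=> y xy i; rewrite (le_lt_trans _ xy)//.
    by rewrite (le_trans _ (ler_coord_enorm _ i))// !mxE.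
  rewrite midpointE (@le_trans _ _ (2^-1%:E * (b + b))%E)//.
    rewrite lee_pmul2l ?lte_fin ?invr_gt0//.
    apply: leeD; first exact: (box_ball _ s1 eta0 nupE).
    exact: (box_ball _ sn1 eta0 nunE).
  by rewrite /b -EFinD -EFinM lee_fin; set y := M * _; lra.
- move=> u u01 t; split.
    have msw := measurable_shift (c ord0 i0) (measurable_switch t).
    rewrite [LHS]midpointE (marginal msw nupE) (marginal msw nunE).
    rewrite switch_law_pos// switch_law_neg// -EFinD -EFinM.
    by rewrite subrK mulr1.
  have mstrip : measurable [set v : R | (`|v - c ord0 i0| <= t)%R].
    exact: (measurable_shift (c ord0 i0) (measurable_abs_le t)).
  rewrite [LHS]midpointE (marginal mstrip nupE) (marginal mstrip nunE).
  rewrite (strip_law s1 u01) (strip_law sn1 u01) -EFinD -EFinM.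
  by congr (_%:E); lra.
Qed.

End source.

(** * Couplings and almost sure statements *)

Section almost_surely.
Context {disp} {T : measurableType disp} {R : realType}.
Variable P : probability T R.

Lemma ae_full (A : set T) : measurable A -> P A = 1%E -> (\forall x \ae P, A x).
Proof.
move=> mA PA; exists (~` A); split=> //; first exact: measurableC.
by rewrite probability_setC// PA subee.
Qed.

Lemma ae_mono (A B : T -> Prop) :
  (forall x, A x -> B x) -> (\forall x \ae P, A x) -> \forall x \ae P, B x.
Proof. exact: filterS. Qed.

Lemma ae_measure_le (A B : set T) : measurable A -> measurable B ->
  (\forall x \ae P, A x -> B x) -> (P A <= P B)%E.
Proof.
move=> mA mB AB.
have -> : P A = (\int[P]_x (\1_A x)%:E)%E by rewrite integral_indic// setIT.
have -> : P B = (\int[P]_x (\1_B x)%:E)%E by rewrite integral_indic// setIT.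
apply: ae_ge0_le_integral => //.
- by apply/measurable_EFinP; exact: measurable_indic.
- by apply/measurable_EFinP; exact: measurable_indic.
apply: filterS AB => x AB _; rewrite lee_fin !indicE ler_nat.
by case: (boolP (x \in A)) => // /set_mem /AB /mem_set ->.
Qed.

Lemma ae_measure_eq (A B : set T) : measurable A -> measurable B ->
  (\forall x \ae P, A x <-> B x) -> P A = P B.
Proof.
move=> mA mB AB; apply/eqP; rewrite eq_le.
by rewrite !ae_measure_le//; apply: filterS AB => x [].
Qed.

Lemma ae_bounded_integrable (f : T -> R) (K : R) :
  measurable_fun [set: T] f -> (\forall x \ae P, `|f x| <= K) ->
  P.-integrable [set: T] (EFin \o f).
Proof.
move=> mf fK; apply/integrableP; split; first exact/measurable_EFinP.
apply: (@le_lt_trans _ _ (\int[P]_x (cst `|K|%:E x))%E); last first.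
  rewrite integral_cst// lte_mul_pinfty//.
  exact: le_lt_trans (probability_le1 P measurableT) (ltry 1).
apply: ae_ge0_le_integral => //.
- by do 2 apply: measurableT_comp => //.
- by move=> x _; rewrite lee_fin.
- by apply: filterS fK => x fK _; rewrite lee_fin (le_trans fK)// ler_norm.
Qed.

Lemma ae_eq_Rintegral (f g : T -> R) :
  measurable_fun [set: T] f -> measurable_fun [set: T] g ->
  (\forall x \ae P, f x = g x) -> \int[P]_x f x = \int[P]_x g x.
Proof.
move=> mf mg fg; congr fine; apply: ae_eq_integral => //.
- exact/measurable_EFinP.
- exact/measurable_EFinP.
- by apply: filterS fg => x -> _.
Qed.

Lemma ae_ge0_Rintegral (f : T -> R) : P.-integrable [set: T] (EFin \o f) ->
  (\forall x \ae P, 0 <= f x) ->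
  0 <= \int[P]_x f x /\ (\int[P]_x f x = 0 -> (\forall x \ae P, f x = 0)).
Proof.
move=> fi f0; have mf : measurable_fun [set: T] f.
  by apply/measurable_EFinP; case/integrableP : fi.
have -> : \int[P]_x f x = \int[P]_x `|f x|.
  apply: ae_eq_Rintegral => //; first exact: measurableT_comp.
  by apply: filterS f0 => x /ger0_norm.
split; first exact: Rintegral_ge0.
move=> I0; have : (\int[P]_x `|(EFin \o f) x| = 0)%E.
  rewrite -[LHS]fineK; first by congr (_%:E); exact: I0.
  by apply: integrable_fin_num => //; exact: integrable_abse.
move=> /ae_eq_integral_abs => /(_ measurableT).
case/integrableP : fi => mfi _ /(_ mfi).
by apply: filterS => x /(_ Logic.I) [].
Qed.

End almost_surely.

Section law_lemmas.
Context {d1 d2} {T1 : measurableType d1} {T2 : measurableType d2} {R : realType}.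
Variables (P : probability T1 R) (f : T1 -> T2).
Hypothesis mf : measurable_fun [set: T1] f.

Lemma ae_law (A : set T2) : measurable A -> (\forall x \ae P, A (f x)) ->
  (\forall y \ae law P mf, A y).
Proof.
move=> mA [N [mN PN subN]]; exists (~` A); split=> //; first exact: measurableC.
rewrite lawE; apply: (@subset_measure0 _ _ _ P _ N) => //.
by rewrite -[X in measurable X]setTI; apply: mf => //; exact: measurableC.
Qed.

Lemma Rintegral_law (h : T2 -> R) : measurable_fun [set: T2] h ->
  P.-integrable [set: T1] (EFin \o (h \o f)) ->
  \int[law P mf]_y h y = \int[P]_x h (f x).
Proof.
move=> mh hi; congr fine; rewrite -[LHS]/(\int[pushforward P f]_y (h y)%:E)%E.
by rewrite integral_pushforward//; exact/measurable_EFinP.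
Qed.

End law_lemmas.

Section coupling_lemmas.
Context {d1 d2} {T1 : measurableType d1} {T2 : measurableType d2} {R : realType}.
Variables (P1 : probability T1 R) (P2 : probability T2 R).
Variable g : probability (T1 * T2)%type R.
Hypothesis gP : coupling P1 P2 g.

Lemma coupling_ae1 (Q : T1 -> Prop) :
  (\forall x \ae P1, Q x) -> (\forall z \ae g, Q z.1).
Proof.
move=> [N [mN PN subN]]; exists (N `*` setT); split=> //.
- exact: measurableX.
- by rewrite (proj1 gP).
- by move=> z /= nQ; split=> //; exact: subN.
Qed.

Lemma coupling_ae2 (Q : T2 -> Prop) :
  (\forall x \ae P2, Q x) -> (\forall z \ae g, Q z.2).
Proof.
move=> [N [mN PN subN]]; exists (setT `*` N); split=> //.
- exact: measurableX.
- by rewrite (proj2 gP).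
- by move=> z /= nQ; split=> //; exact: subN.
Qed.

Lemma coupling_Rintegral1 (h : T1 -> R) : measurable_fun [set: T1] h ->
  g.-integrable [set: _] (EFin \o (h \o fst)) ->
  \int[g]_z h z.1 = \int[P1]_x h x.
Proof.
move=> mh hi; rewrite -(Rintegral_law measurable_fst mh hi).
congr fine; apply: eq_measure_integral => A mA _.
apply: etrans (proj1 gP A mA); rewrite -[LHS]/(g (fst @^-1` A)).
by congr (g _); rewrite predeqE => z; split=> [|[]].
Qed.

Lemma coupling_Rintegral2 (h : T2 -> R) : measurable_fun [set: T2] h ->
  g.-integrable [set: _] (EFin \o (h \o snd)) ->
  \int[g]_z h z.2 = \int[P2]_x h x.
Proof.
move=> mh hi; rewrite -(Rintegral_law measurable_snd mh hi).
congr fine; apply: eq_measure_integral => A mA _.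
apply: etrans (proj2 gP A mA); rewrite -[LHS]/(g (snd @^-1` A)).
by congr (g _); rewrite predeqE => z; split=> [|[]].
Qed.

End coupling_lemmas.

(** * Kantorovich duality *)

Definition in_box {R : realType} {d : nat} (K : R) (x : 'rV[R]_d) :=
  forall i, `|x ord0 i| <= K.

Section duality.
Context {R : realType} {d : nat}.
Local Notation E := (borelRd R d).
Variables (rho mu : probability E R) (g : probability (E * E)%type R).
Hypothesis gP : coupling rho mu g.
Variables (H L : E -> R) (K : R).
Hypotheses (mH : measurable_fun [set: E] H) (mL : measurable_fun [set: E] L).
Hypothesis rho_bd : \forall x \ae rho, in_box K x /\ `|H x| <= K.
Hypothesis mu_bd : \forall y \ae mu, in_box K y /\ `|L y| <= K.

Let HLi : g.-integrable [set: _] (EFin \o (H \o fst)) /\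
  g.-integrable [set: _] (EFin \o (L \o snd)).
Proof.
split; apply: (@ae_bounded_integrable _ _ _ _ _ K).
- exact: measurableT_comp mH measurable_fst.
- by apply: filterS (coupling_ae1 gP rho_bd) => z [].
- exact: measurableT_comp mL measurable_snd.
- by apply: filterS (coupling_ae2 gP mu_bd) => z [].
Qed.

Let mdot : measurable_fun [set: E * E] (fun z => dotp z.1 z.2).
Proof. exact: measurable_dotp measurable_fst measurable_snd. Qed.

Let doti : g.-integrable [set: _] (EFin \o (fun z => dotp z.1 z.2)).
Proof.
apply: (@ae_bounded_integrable _ _ _ _ _ (d%:R * (K * K))) => //.
apply: filterS2 (coupling_ae1 gP rho_bd) (coupling_ae2 gP mu_bd).
move=> z [xK _] [yK _].
exact: dotp_le.
Qed.

Let sumi : g.-integrable [set: _] (EFin \o (fun z => H z.1 + L z.2)).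
Proof. by have [Hi Li] := HLi; exact: (integrableD measurableT Hi Li). Qed.

Lemma slack_integrable :
  g.-integrable [set: _] (EFin \o (fun z => H z.1 + L z.2 - dotp z.1 z.2)).
Proof. exact: (integrableB measurableT sumi doti). Qed.

(** The integrals of [H] and [L] are the same for all plans, so a plan falls
short of the dual value by the integral of the slack. *)
Lemma correlation_slack : correlation g = \int[rho]_x H x + \int[mu]_y L y -
  \int[g]_z (H z.1 + L z.2 - dotp z.1 z.2).
Proof.
have [Hi Li] := HLi.
rewrite RintegralB// RintegralD//.
rewrite (coupling_Rintegral1 gP mH Hi) (coupling_Rintegral2 gP mL Li).
by rewrite opprB addrC subrK.
Qed.

End duality.

(** Half the squared distance is the slack of the potentials [|x|^2/2] and
[|y|^2/2]. *)
Lemma quadratic_costE {R : realType} {d : nat}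
    (rho mu : probability (borelRd R d) R)
    (g : probability (borelRd R d * borelRd R d)%type R) (K : R) :
  coupling rho mu g ->
  (\forall x \ae rho, in_box K x) ->
  (\forall y \ae mu, in_box K y) ->
  quadratic_cost g = (2 * (\int[rho]_x (dotp x x / 2) + \int[mu]_y (dotp y y / 2)
    - correlation g))%:E.
Proof.
move=> gP rK mK.
have md : measurable_fun [set: borelRd R d] (fun x => dotp x x / 2).
  by apply: measurable_funM => //; exact: measurable_dotp.
pose K' := `|K| + d%:R * (K * K).
have dKK : 0 <= d%:R * (K * K) by rewrite mulr_ge0// -expr2 sqr_ge0.
have dK' (x : borelRd R d) : in_box K x ->
    in_box K' x /\ `|dotp x x / 2| <= K'.
  move=> xK; have dxx := dotp_le xK xK.
  split=> [i|].
    by rewrite (le_trans (xK i))// (le_trans (ler_norm _))// lerDl.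
  have K0 := normr_ge0 K.
  rewrite normrM (@ger0_norm _ 2^-1)// /K'; have := normr_ge0 (dotp x x).
  by move: dKK dxx; set a := `|dotp _ _|; set b := _ * (K * K); lra.
have rK' : \forall x \ae rho, in_box K' x /\ `|dotp x x / 2| <= K'.
  exact: filterS dK' rK.
have mK' : \forall y \ae mu, in_box K' y /\ `|dotp y y / 2| <= K'.
  exact: filterS dK' mK.
have si := slack_integrable gP md md rK' mK'.
rewrite (correlation_slack gP md md rK' mK') subKr.
rewrite -RintegralZl// /Rintegral fineK.
  apply: eq_integral => z _; rewrite sqr_enormB; congr (_%:E).
  by field.
apply: integrable_fin_num => //.
exact: (integrableZl measurableT 2 si).
Qed.

(** * Wasserstein distances *)

Lemma Lnorm_ae0 {disp} {T : measurableType disp} {R : realType}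
    (P : probability T R) (r : \bar R) (f : T -> R) : (1 <= r)%E ->
  measurable_fun [set: T] f -> (\forall x \ae P, f x = 0) ->
  Lnorm P r (EFin \o f) = 0%E.
Proof.
move=> r1 mf f0.
rewrite unlock; case: r r1 => [s s1|_|//].
  have s0 : 0 < s by rewrite (lt_le_trans ltr01)// -lee_fin.
  rewrite (ae_eq_integral (cst 0%E))//=.
  - by rewrite integral0 poweR0r// invr_neq0// gt_eqF.
  - apply/measurable_EFinP.
    apply: (measurableT_comp (measurable_powR s)).
    exact: measurableT_comp mf.
  - by apply: filterS f0 => z -> _; rewrite normr0 powR0// gt_eqF.
case: ifPn => // D1; apply: ess_sup_ae_cst => //.
by apply: filterS f0 => z /= ->; rewrite normr0.
Qed.

Section wasserstein.
Context {R : realType} {d : nat}.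
Local Notation E := (borelRd R d).
Implicit Types (rho mu : probability E R) (g : probability (E * E)%type R).

(** As [G] carries [g0], any transport of [g0] to [g1] brings the whole
[g1]-mass of [B] from [G], over a distance at least [delta]. *)
Lemma plan_wasserstein_ge (q delta : R) (G B : set (E * E)) g0 g1 :
  1 <= q -> 0 <= delta -> measurable B -> (\forall z \ae g0, G z) ->
  (forall z w, G z -> B w ->
     delta <= enorm (z.1 - w.1) \/ delta <= enorm (z.2 - w.2)) ->
  (((delta `^ q)%:E * g1 B) `^ q^-1 <= plan_wasserstein q g0 g1)%E.
Proof.
move=> q1 delta0 mB Gz sep; have q0 : 0 < q by rewrite (lt_le_trans ltr01).
apply: gt0_ler_poweR.
- by rewrite invr_ge0 ltW.
- by rewrite in_itv/= leey andbT mule_ge0// lee_fin powR_ge0.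
- rewrite in_itv/= leey andbT; apply: le_ereal_inf_tmp => _ [p _ <-].
  by apply: integral_ge0 => z _; rewrite lee_fin addr_ge0// powR_ge0.
apply: le_ereal_inf_tmp => _ [p pP <-].
have mB2 : measurable (setT `*` B : set ((E * E) * (E * E))).
  exact: measurableX.
have <- : (\int[p]_z (delta `^ q * \1_(setT `*` B) z)%:E =
    (delta `^ q)%:E * g1 B)%E.
  under eq_integral do rewrite EFinM.
  rewrite ge0_integralZl//.
  - by rewrite integral_indic// setIT; congr (_ * _)%E; exact: (proj2 pP).
  - by apply/measurable_EFinP; exact: measurable_indic.
  - by rewrite lee_fin powR_ge0.
apply: ae_ge0_le_integral => //.
- by move=> z _; rewrite lee_fin mulr_ge0// powR_ge0.
- apply/measurable_EFinP; apply: measurable_funM => //.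
- by move=> z _; rewrite lee_fin addr_ge0// powR_ge0.
- pose fst4 := @measurable_fst _ _ (E * E)%type (E * E)%type.
  pose snd4 := @measurable_snd _ _ (E * E)%type (E * E)%type.
  have m11 := measurableT_comp (@measurable_fst _ _ E E) fst4.
  have m12 := measurableT_comp (@measurable_fst _ _ E E) snd4.
  have m21 := measurableT_comp (@measurable_snd _ _ E E) fst4.
  have m22 := measurableT_comp (@measurable_snd _ _ E E) snd4.
  apply/measurable_EFinP; apply: measurable_funD.
    exact: (measurableT_comp (measurable_powR q) (measurable_enormB m11 m12)).
  exact: (measurableT_comp (measurable_powR q) (measurable_enormB m21 m22)).
apply: filterS (coupling_ae1 pP Gz) => z Gz1 _; rewrite lee_fin indicE.
have [/set_mem[_ Bz2]|_] := boolP (z \in _); last first.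
  by rewrite mulr0 addr_ge0// powR_ge0.
rewrite mulr1.
have mono v : delta <= v -> delta `^ q <= v `^ q.
  move=> dv; apply: ge0_ler_powR; rewrite ?nnegrE ?(ltW q0)//.
  exact: le_trans dv.
have [/mono h|/mono h] := sep _ _ Gz1 Bz2.
  by rewrite (le_trans h)// lerDl powR_ge0.
by rewrite (le_trans h)// lerDr powR_ge0.
Qed.

Lemma wasserstein_self (r : \bar R) rho :
  (1 <= r)%E -> wasserstein r rho rho = 0%E.
Proof.
move=> r1; apply/eqP; rewrite eq_le; apply/andP; split; last first.
  by apply: le_ereal_inf_tmp => _ [g _ <-]; exact: Lnorm_ge0.
pose D := law rho
  (measurable_fun_pair (@measurable_id _ E setT) (@measurable_id _ E setT)).
have DP : coupling rho rho D.
  by split=> A mA; rewrite lawE; congr (rho _); rewrite predeqE => x;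
    split=> [[]|].
apply: (@le_trans _ _ (Lnorm D r (fun z => (enorm (z.1 - z.2))%:E))).
  by apply: ereal_inf_lbound; exists D.
have md : measurable_fun [set: E * E] (fun z => enorm (z.1 - z.2)).
  exact: measurable_enormB measurable_fst measurable_snd.
have D0 : \forall z \ae D, enorm (z.1 - z.2) = 0.
  apply: ae_law.
    rewrite [X in measurable X](_ : _ =
      (fun z : E * E => enorm (z.1 - z.2)) @^-1` [set 0])//.
    by rewrite -[X in measurable X]setTI; exact: md.
  by apply: aeW => x /=; rewrite subrr enorm0.
by rewrite (Lnorm_ae0 r1 md D0).
Qed.

Lemma wasserstein2_optimal rho mu g : optimal_plan rho mu g ->
  (wasserstein 2%:E rho mu ^+ 2 = quadratic_cost g)%E.
Proof.
move=> [gP gopt].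
have cost_ge0 g' : (0 <= quadratic_cost g')%E.
  by apply: integral_ge0 => z _; rewrite lee_fin sqr_ge0.
have LnormE g' : Lnorm g' 2%:E (fun z => (enorm (z.1 - z.2))%:E) =
    (quadratic_cost g' `^ 2^-1)%E.
  rewrite unlock; congr (_ `^ _)%E; apply: eq_integral => z _.
  by rewrite abse_EFin poweR_EFin ger0_norm ?enorm_ge0// powR_mulrn ?enorm_ge0.
have -> : wasserstein 2%:E rho mu = (quadratic_cost g `^ 2^-1)%E.
  apply/eqP; rewrite eq_le; apply/andP; split.
    by apply: ereal_inf_lbound; exists g => //; rewrite LnormE.
  apply: le_ereal_inf_tmp => _ [g' g'P <-]; rewrite LnormE.
  apply: gt0_ler_poweR; rewrite ?in_itv/= ?leey ?cost_ge0//.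
  exact: gopt.
case: (quadratic_cost g) (cost_ge0 g) => [k k0| |//].
  by rewrite poweR_EFin -EFin_expe powR12_sqrt ?sqr_sqrtr.
by rewrite poweRyr ?invr_neq0// expe2 mulyy.
Qed.

End wasserstein.

(** * The swapped plans *)

Section swap.
Context {R : realType} {d : nat}.
Local Notation E := (borelRd R d).
Variables (theta r b : R) (c yc : 'rV[R]_d) (i0 i1 : 'I_d).
Variable rho : probability E R.
Hypotheses (theta_gt0 : 0 < theta) (r_gt0 : 0 < r) (b_gt0 : 0 < b).
Hypothesis i1_neq0 : i1 != i0.
Hypothesis rho_wedge :
  \forall x \ae rho, (wedge r c i0 1 `|` wedge r c i0 (-1) : set E) x.

(** The half width of the strip of [rho]-mass [u]. *)
Definition width (u : R) : R := r * u `^ theta^-1.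

Definition strip (t : R) : set E := [set x | (`|x ord0 i0 - c ord0 i0| <= t)%R].

Hypothesis rho_switch : forall u, 0 <= u <= 1 ->
  rho [set x | switch (width u) (x ord0 i0 - c ord0 i0)] = (2^-1)%:E.
Hypothesis rho_strip : forall u, 0 <= u <= 1 ->
  rho (strip (width u)) = u%:E.

Definition side (t v : R) : R := 2 * \1_(switch t) v - 1.

Definition target (s : R) : 'rV[R]_d := yc + (s * b) *: delta_mx ord0 i0.

Definition transport (t : R) (x : E) : E :=
  target (side t (x ord0 i0 - c ord0 i0)).

Lemma sideP t v : switch t v /\ side t v = 1 \/ ~ switch t v /\ side t v = -1.
Proof.
rewrite /side indicE; have [/set_mem ?|] := boolP (v \in _); [left|right].
  by split=> //; rewrite mulr1; lra.
by split; [move/mem_set; exact/negP|rewrite mulr0 sub0r].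
Qed.

Lemma target_coord s i : target s ord0 i = yc ord0 i + (i == i0)%:R * (s * b).
Proof. by rewrite !mxE eqxx mulrC. Qed.

Lemma measurable_transport t : measurable_fun [set: E] (transport t).
Proof.
apply: measurable_fun_Rd => i.
rewrite [X in measurable_fun _ X](_ : _ = fun x : E => yc ord0 i +
  (i == i0)%:R * (side t (x ord0 i0 - c ord0 i0) * b)); last first.
  by apply/funext => x; rewrite /transport target_coord.
apply: measurable_funD => //; apply: measurable_funM => //.
apply: measurable_funM => //.
have mside : measurable_fun [set: R] (side t).
  apply: measurable_funB => //; apply: measurable_funM => //.
  by apply: measurable_indic; exact: measurable_switch.
apply: (measurableT_comp mside); apply: measurable_funB => //.
exact: measurable_coord.
Qed.

(** [switch 0] is the positive half-line, so [plan 0] sends each point to the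
end of the segment on its own side; [plan t] does the opposite in the strip. *)
Definition plan t : probability (E * E)%type R :=
  law rho (measurable_fun_pair (@measurable_id _ E setT) (measurable_transport t)).

Definition image_measure : probability E R := law rho (measurable_transport 0).

Let width0 : width 0 = 0.
Proof. by rewrite /width powR0 ?mulr0// invr_neq0// gt_eqF. Qed.

Let width_ge0 u : 0 <= width u.
Proof. by rewrite mulr_ge0 ?powR_ge0// ltW. Qed.

Let measurable_pos (A : set R) : measurable A ->
  measurable ([set x | A (x ord0 i0 - c ord0 i0)] : set E).
Proof.
move=> mA.
have mf : measurable_fun [set: E] (fun x : E => x ord0 i0 - c ord0 i0).
  by apply: measurable_funB => //; exact: measurable_coord.
by rewrite -[X in measurable X]setTI; exact: mf.
Qed.

Let mswitch t := measurable_pos (measurable_switch t).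

Let transportE t x : transport t x = target 1 /\ switch t (x ord0 i0 - c ord0 i0)
  \/ transport t x = target (-1) /\ ~ switch t (x ord0 i0 - c ord0 i0).
Proof.
rewrite /transport.
by case: (sideP t (x ord0 i0 - c ord0 i0)) => -[? ->]; [left|right].
Qed.

(** The law of a map with two values depends only on the mass of one fibre,
and all the sets [switch (width u)] have mass 1/2. *)
Lemma transport_law u (B : set E) : 0 <= u <= 1 -> measurable B ->
  rho (transport (width u) @^-1` B) = image_measure B.
Proof.
move=> u01 mB; rewrite -[image_measure B]/(rho (transport 0 @^-1` B)).
have h0 : rho [set x | switch 0 (x ord0 i0 - c ord0 i0)] = (2^-1)%:E.
  by have := @rho_switch 0; rewrite width0; apply; rewrite lexx ler01.
have hu := rho_switch u01.
set t := width u in hu *.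
have pre s : (B (target 1) /\ B (target (-1)) -> transport s @^-1` B = setT) /\
    (B (target 1) /\ ~ B (target (-1)) -> transport s @^-1` B =
      [set x | switch s (x ord0 i0 - c ord0 i0)]) /\
    (~ B (target 1) /\ B (target (-1)) -> transport s @^-1` B =
      ~` [set x | switch s (x ord0 i0 - c ord0 i0)]) /\
    (~ B (target 1) /\ ~ B (target (-1)) -> transport s @^-1` B = set0).
  by split; [|split; [|split]] => -[Bp Bn]; rewrite predeqE => x /=;
    case: (transportE s x) => -[-> ?].
have [Bp|Bp] := pselect (B (target 1));
  have [Bn|Bn] := pselect (B (target (-1))).
- by rewrite (proj1 (pre t))// (proj1 (pre 0)).
- by rewrite (proj1 (proj2 (pre t)))// (proj1 (proj2 (pre 0)))// hu -h0.
- rewrite (proj1 (proj2 (proj2 (pre t))))// (proj1 (proj2 (proj2 (pre 0))))//.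
  by rewrite !probability_setC ?hu ?h0//; exact: mswitch.
- by rewrite (proj2 (proj2 (proj2 (pre t))))// (proj2 (proj2 (proj2 (pre 0)))).
Qed.

Lemma plan_coupling u : 0 <= u <= 1 ->
  coupling rho image_measure (plan (width u)).
Proof.
move=> u01; split=> A mA; rewrite -[LHS]/(rho (_ @^-1` _)).
  by congr (rho _); rewrite predeqE => x; split=> [[]|].
rewrite -(transport_law u01 mA).
by congr (rho _); rewrite predeqE => x; split=> [[]|].
Qed.

(** The maximum over the two ends [y] of the segment of the affine functions
[dotp x y - target_potential y]: off the hyperplane [x_i0 = c_i0] its gradient is
[transport 0]. *)
Definition source_potential (x : E) : R :=
  dotp x yc + b * `|x ord0 i0 - c ord0 i0|.

Definition target_potential (y : E) : R := dotp c (y - yc).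

Definition slack (z : E * E) : R :=
  source_potential z.1 + target_potential z.2 - dotp z.1 z.2.

Let dotpDdelta (x y : 'rV[R]_d) (a : R) :
  dotp x (y + a *: delta_mx ord0 i0) = dotp x y + a * x ord0 i0.
Proof.
rewrite /dotp (bigD1 i0)//= [in RHS](bigD1 i0)//= !mxE !eqxx mulr1.
rewrite (eq_bigr (fun i => x ord0 i * y ord0 i)) => [|i /negbTE ii0].
  by ring.
by rewrite !mxE eqxx ii0 mulr0 addr0.
Qed.

Lemma slack_target (x : E) s : slack (x, target s) =
  b * (`|x ord0 i0 - c ord0 i0| - s * (x ord0 i0 - c ord0 i0)).
Proof.
rewrite /slack /source_potential /target_potential /target dotpDdelta.
rewrite [X in dotp c X](_ : _ = 0 + (s * b) *: delta_mx ord0 i0); last first.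
  by rewrite addrAC subrr.
rewrite dotpDdelta (_ : dotp c 0 = 0); first by ring.
by rewrite /dotp big1// => i _; rewrite mxE mulr0.
Qed.

Lemma measurable_source_potential : measurable_fun [set: E] source_potential.
Proof.
apply: measurable_funD; first exact: measurable_dotp.
apply: measurable_funM => //; apply: measurableT_comp => //.
by apply: measurable_funB => //; exact: measurable_coord.
Qed.

Lemma measurable_target_potential : measurable_fun [set: E] target_potential.
Proof. by apply: measurable_dotp => //; exact: measurable_subRd. Qed.

Lemma measurable_slack : measurable_fun [set: E * E] slack.
Proof.
apply: measurable_funB; last exact: measurable_dotp measurable_fst measurable_snd.
apply: measurable_funD.
  exact: measurableT_comp measurable_source_potential measurable_fst.
exact: measurableT_comp measurable_target_potential measurable_snd.
Qed.

Lemma image_measure_support :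
  \forall y \ae image_measure, y = target 1 \/ y = target (-1).
Proof.
apply: ae_law.
  rewrite [X in measurable X](_ : _ = [set target 1] `|` [set target (-1)])//.
  by apply: measurableU; exact: measurable_point_Rd.
by apply: aeW => x; case: (transportE 0 x) => -[-> _]; [left|right].
Qed.

Lemma supports_bounded : exists K,
  (\forall x \ae rho, in_box K x /\ `|source_potential x| <= K) /\
  (\forall y \ae image_measure, in_box K y /\ `|target_potential y| <= K).
Proof.
have nc := enorm_ge0 c; have ny := enorm_ge0 yc.
pose K0 := enorm c + enorm yc + r + b.
have K00 : 0 <= K0 by rewrite /K0; move: r_gt0 b_gt0; lra.
pose K := K0 + d%:R * (K0 * K0) + b * r.
have dK : 0 <= d%:R * (K0 * K0) by rewrite !mulr_ge0.
have br : 0 <= b * r by rewrite mulr_ge0 ?ltW.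
have K0K : K0 <= K by rewrite /K; lra.
have cK i : `|c ord0 i| <= K0.
  by have := ler_coord_enorm c i; rewrite /K0; move: r_gt0 b_gt0; lra.
have yK i : `|yc ord0 i| <= K0.
  by have := ler_coord_enorm yc i; rewrite /K0; move: r_gt0 b_gt0; lra.
exists K; split.
  have h s (x : E) : `|s| = 1 -> wedge r c i0 s x ->
      in_box K x /\ `|source_potential x| <= K.
    move=> s1 xW.
    have xc i : `|x ord0 i - c ord0 i| <= r.
      have [/andP[h0 hr] _] := xW i.
      by rewrite -[leLHS]mul1r -s1 -normrM ger0_norm// ltW.
    have xK i : `|x ord0 i| <= K0.
      rewrite -[x ord0 i](subrK (c ord0 i)) (le_trans (ler_normD _ _))//.
      have := xc i; have := ler_coord_enorm c i.
      by rewrite /K0; move: b_gt0; lra.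
    split=> [i|]; first exact: le_trans (xK i) K0K.
    rewrite (le_trans (ler_normD _ _))// normrM (gtr0_norm b_gt0) normr_id.
    have := dotp_le xK yK; have := xc i0; rewrite -(ler_pM2l b_gt0) /K.
    by move: K00; lra.
  apply: ae_mono rho_wedge => x [|]; apply: h; first exact: normr1.
  exact: normrN1.
have h s : `|s| = 1 ->
    in_box K (target s) /\ `|target_potential (target s)| <= K.
  move=> s1.
  have sb i : `|(i == i0)%:R * (s * b)| <= b.
    rewrite !normrM s1 mul1r (gtr0_norm b_gt0) normr_nat ler_piMl ?(ltW b_gt0)//.
    by rewrite lern1 leq_b1.
  split=> [i|].
    rewrite target_coord (le_trans (ler_normD _ _))// (le_trans _ K0K)//.
    have := ler_coord_enorm yc i; have := sb i.
    by rewrite /K0; move: r_gt0; lra.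
  rewrite /target_potential.
  have tK i : `|(target s - yc) ord0 i| <= K0.
    rewrite !mxE addrAC subrr add0r eqxx/= mulrC (le_trans (sb i))//.
    by rewrite /K0; move: r_gt0; lra.
  have := dotp_le cK tK; rewrite /K; move: K00 br.
  by set a := `|_|; set e := _ * (K0 * K0); lra.
apply: ae_mono image_measure_support => y [->|->]; apply: h.
  exact: normr1.
exact: normrN1.
Qed.

Lemma slack_ge0 g : coupling rho image_measure g ->
  \forall z \ae g, 0 <= slack z.
Proof.
move=> gP; apply: ae_mono (coupling_ae2 gP image_measure_support) => -[x y] /=.
have := ler_norm (x ord0 i0 - c ord0 i0); rewrite -normrN.
have := ler_norm (- (x ord0 i0 - c ord0 i0)).
move=> h1 h2; rewrite normrN in h1 h2.
by move=> [->|->]; rewrite slack_target mulr_ge0 ?(ltW b_gt0)//; lra.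
Qed.

Let loss t (x : E) : R := slack (x, transport t x).

Let loss_bound t x : 0 <= t ->
  0 <= loss t x <= 2 * b * t * \1_(strip t) x.
Proof.
move=> t0; rewrite /loss /transport slack_target indicE.
set v := x ord0 i0 - c ord0 i0.
have -> : (x \in strip t) = (`|v| <= t).
  by apply/idP/idP; rewrite inE.
have bt : 0 <= b * t by rewrite mulr_ge0 ?(ltW b_gt0).
have [[[tv|[tv v0]] ->]|[nsw ->]] := sideP t v.
- have v0 := le_lt_trans t0 tv.
  rewrite ger0_norm ?(ltW v0)// mul1r subrr mulr0 lexx/=.
  by rewrite mulr_ge0// -mulrA mulr_ge0.
- have h1 : 0 <= b * - v by rewrite mulr_ge0 ?(ltW b_gt0)// oppr_ge0 ltW.
  have h2 : b * - v <= b * t by rewrite ler_pM2l// lerNl.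
  by rewrite ltr0_norm// lerNl tv mulr1 mul1r; apply/andP; split; lra.
- have [v0|v0] := leP 0 v; last first.
    rewrite ltr0_norm// mulN1r opprK addNr mulr0 lexx/=.
    by rewrite mulr_ge0// -mulrA mulr_ge0.
  have vt : v <= t by rewrite leNgt; apply/negP => tv; apply: nsw; left.
  have h1 : 0 <= b * v by rewrite mulr_ge0 ?(ltW b_gt0).
  have h2 : b * v <= b * t by rewrite ler_pM2l.
  by rewrite ger0_norm// vt mulr1 mulN1r opprK; apply/andP; split; lra.
Qed.

Let loss0 x : loss 0 x = 0.
Proof.
have := loss_bound x (lexx 0); rewrite mulr0 mul0r => /le_anti h.
by rewrite -h.
Qed.

Let measurable_loss t : measurable_fun [set: E] (loss t).
Proof.
exact: (measurableT_comp measurable_slack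
  (measurable_fun_pair (@measurable_id _ E setT) (measurable_transport t))).
Qed.

Let loss_integrable t : 0 <= t -> rho.-integrable [set: E] (EFin \o loss t).
Proof.
move=> t0; apply: (ae_bounded_integrable (K := 2 * b * t)).
  exact: measurable_loss.
apply: aeW => x; have /andP[l0 l1] := loss_bound x t0.
have bt : 0 <= 2 * b * t by rewrite !mulr_ge0// ltW.
rewrite ger0_norm// (le_trans l1)// indicE ler_piMr// lern1; exact: leq_b1.
Qed.

Let best : R :=
  \int[rho]_x source_potential x + \int[image_measure]_y target_potential y.

Lemma correlation_coupling g : coupling rho image_measure g ->
  correlation g = best - \int[g]_z slack z.
Proof.
move=> gP; have [K [rK mK]] := supports_bounded.
exact: (correlation_slack gP measurable_source_potential
  measurable_target_potential rK mK).
Qed.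

Let slack_int g : coupling rho image_measure g ->
  g.-integrable [set: E * E] (EFin \o slack).
Proof.
move=> gP; have [K [rK mK]] := supports_bounded.
exact: (slack_integrable gP measurable_source_potential
  measurable_target_potential rK mK).
Qed.

Lemma correlation_plan u : 0 <= u <= 1 ->
  correlation (plan (width u)) = best - \int[rho]_x loss (width u) x.
Proof.
move=> u01; rewrite (correlation_coupling (plan_coupling u01)); congr (_ - _).
apply: Rintegral_law; first exact: measurable_slack.
exact: loss_integrable.
Qed.

Let plan0_coupling : coupling rho image_measure (plan 0).
Proof. by rewrite -width0; apply: plan_coupling; rewrite lexx ler01. Qed.

Lemma correlation_plan0 : correlation (plan 0) = best.
Proof.
rewrite -width0 correlation_plan ?lexx ?ler01// width0.
under eq_Rintegral do rewrite loss0.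
by rewrite Rintegral_cst// mul0r subr0.
Qed.

Let mstrip u : measurable (strip (width u)).
Proof. exact: measurable_pos (measurable_abs_le (width u)). Qed.

(** Exchanging the destinations of a point costs [2 b] times its distance to the
hyperplane, which is at most [width u] in the strip. *)
Lemma correlation_gap_le u : 0 <= u <= 1 ->
  correlation (plan 0) - correlation (plan (width u)) <= 2 * b * width u * u.
Proof.
move=> u01; rewrite correlation_plan0 correlation_plan// subKr.
rewrite -lee_fin /Rintegral fineK; last first.
  by apply: integrable_fin_num => //; exact: loss_integrable.
have bw : 0 <= 2 * b * width u.
  by rewrite mulr_ge0 ?width_ge0// mulr_ge0// ltW.
pose S := strip (width u).
have -> : (2 * b * width u * u)%:E =
    (\int[rho]_x (2 * b * width u * \1_S x)%:E)%E.
  under eq_integral do rewrite EFinM.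
  rewrite ge0_integralZl//.
  - rewrite integral_indic//; last exact: mstrip.
    by rewrite setIT [LHS]EFinM; congr (_ * _)%E; apply/esym/rho_strip.
  - by apply/measurable_EFinP; apply: measurable_indic; exact: mstrip.
apply: ge0_le_integral => //.
- by move=> x _; rewrite lee_fin; case/andP : (loss_bound x (width_ge0 u)).
- by apply/measurable_EFinP; exact: measurable_loss.
- apply/measurable_EFinP; apply: measurable_funM => //.
  by apply: measurable_indic; exact: mstrip.
- by move=> x _; rewrite lee_fin; case/andP : (loss_bound x (width_ge0 u)).
Qed.

(** A plan as good as [plan 0] has zero slack almost everywhere. Off the
hyperplane [x_i0 = c_i0] this forces [y] to be [transport 0 x], and a plan
carried by a graph is determined by its first marginal. *)
Lemma correlation_le g : coupling rho image_measure g ->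
  correlation g <= correlation (plan 0) /\
  (correlation g = correlation (plan 0) ->
    forall A, measurable A -> g A = plan 0 A).
Proof.
move=> gP; rewrite correlation_plan0 (correlation_coupling gP).
have [I0 Ieq] := ae_ge0_Rintegral (slack_int gP) (slack_ge0 gP).
split=> [|/eqP]; first by rewrite gerBl.
rewrite -subr_eq0 addrAC subrr add0r oppr_eq0 => /eqP /Ieq gs A mA.
have graph : \forall z \ae g, z.2 = transport 0 z.1.
  apply: filterS3 gs (coupling_ae1 gP rho_wedge)
    (coupling_ae2 gP image_measure_support) => -[x y] /= + xW yT.
  have v0 : x ord0 i0 - c ord0 i0 != 0.
    case: xW => /(_ i0) [/andP[+ _] _]; apply: contraTneq => ->;
      by rewrite mulr0 ltxx.
  rewrite /transport; set v := x ord0 i0 - c ord0 i0 in v0 *.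
  case: yT => ->; rewrite slack_target -/v => /eqP;
    rewrite mulf_eq0 (gt_eqF b_gt0) /= subr_eq0 ?mul1r ?mulN1r => /eqP vE.
    have [[_ ->]//|[nsw _]] := sideP 0 v.
    exfalso; apply: nsw; left.
    by have := normr_ge0 v; rewrite vE lt_neqAle eq_sym v0.
  have [[sw _]|[_ ->]//] := sideP 0 v.
  have := normr_ge0 v; rewrite vE oppr_ge0 => vle0.
  case: sw => [/(le_lt_trans vle0)|[+ v_lt0]]; first by rewrite ltxx.
  by rewrite oppr0 leNgt v_lt0.
have mpair :=
  measurable_fun_pair (@measurable_id _ E setT) (measurable_transport 0).
pose B : set E := (fun x => (x, transport 0 x)) @^-1` A.
have mB : measurable B by rewrite -[X in measurable X]setTI; exact: mpair.
rewrite -[RHS]/(rho B) -(proj1 gP B mB).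
apply: ae_measure_eq => //; first exact: measurableX.
apply: ae_mono graph => -[x y] /= ->.
by split=> [|[]].
Qed.

Lemma quadratic_cost_gap : exists k : R, forall g,
  coupling rho image_measure g -> quadratic_cost g = (k - 2 * correlation g)%:E.
Proof.
have [K [rK mK]] := supports_bounded.
exists (2 * (\int[rho]_x (dotp x x / 2) +
  \int[image_measure]_y (dotp y y / 2))).
move=> g gP; rewrite -mulrBr.
apply: (quadratic_costE (K := K)) => //; first by apply: ae_mono rK => x [].
by apply: ae_mono mK => y [].
Qed.

(** Among plans with fixed marginals, the quadratic cost decreases when the
correlation increases. *)
Lemma plan0_optimal : unique_optimal_plan rho image_measure (plan 0).
Proof.
have [k costE] := quadratic_cost_gap.
split.
  split=> // g gP; rewrite !costE// lee_fin lerB// ler_wpM2l//.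
  by have [] := correlation_le gP.
move=> g [gP gopt]; have [gle geq] := correlation_le gP.
apply: geq; apply/eqP; rewrite eq_le gle/=.
by have := gopt _ plan0_coupling; rewrite !costE// lee_fin; lra.
Qed.

(** For [e = 1] the pairs whose [x] is in one of the two corners, seen in the
coordinate [i1], and whose [y] is on the same side; for [e = -1] those whose [y]
is on the opposite side. The coordinate [i1] is used for [x] because the corners
are apart in it, unlike in [i0]. *)
Definition aligned (e : R) : set (E * E) :=
  [set z : E * E | r / 2 <= z.1 ord0 i1 - c ord0 i1 /\
     b <= e * (z.2 ord0 i0 - yc ord0 i0)] `|`
  [set z : E * E | r / 2 <= - (z.1 ord0 i1 - c ord0 i1) /\
     b <= - (e * (z.2 ord0 i0 - yc ord0 i0))].

Let measurable_aligned e : measurable (aligned e).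
Proof.
have m1 : measurable_fun [set: E * E]
    (fun z : E * E => z.1 ord0 i1 - c ord0 i1).
  apply: measurable_funB => //.
  exact: (measurableT_comp (measurable_coord i1) measurable_fst).
have m2 : measurable_fun [set: E * E]
    (fun z : E * E => e * (z.2 ord0 i0 - yc ord0 i0)).
  apply: measurable_funM => //; apply: measurable_funB => //.
  exact: (measurableT_comp (measurable_coord i0) measurable_snd).
have ge_set (f : E * E -> R) k : measurable_fun [set: E * E] f ->
    measurable [set z | k <= f z].
  move=> mf; rewrite [X in measurable X](_ : _ = f @^-1` `[k, +oo[).
    by rewrite -[X in measurable X]setTI; exact: mf.
  by rewrite predeqE => z; rewrite /= in_itv/= andbT.
apply: measurableU; apply: measurableI; apply: ge_set => //.
  exact: measurableT_comp m1.
exact: measurableT_comp m2.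
Qed.

Definition separation : R := Num.min r (2 * b).

Lemma separation_gt0 : 0 < separation.
Proof. by rewrite /separation lt_min r_gt0 mulr_gt0. Qed.

Lemma aligned_sep (z w : E * E) : aligned 1 z -> aligned (-1) w ->
  separation <= enorm (z.1 - w.1) \/ separation <= enorm (z.2 - w.2).
Proof.
have far1 : r <= `|z.1 ord0 i1 - w.1 ord0 i1| ->
    separation <= enorm (z.1 - w.1).
  move=> h; have := ler_coord_enorm (z.1 - w.1 : 'rV[R]_d) i1; rewrite !mxE.
  by apply: le_trans; rewrite (le_trans _ h)// ge_min lexx.
have far2 : 2 * b <= `|z.2 ord0 i0 - w.2 ord0 i0| ->
    separation <= enorm (z.2 - w.2).
  move=> h; have := ler_coord_enorm (z.2 - w.2 : 'rV[R]_d) i0; rewrite !mxE.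
  by apply: le_trans; rewrite (le_trans _ h)// ge_min lexx orbT.
have abs_ge (k v : R) : k <= v \/ k <= - v -> k <= `|v|.
  by case=> h; rewrite (le_trans h)// ?ler_norm// -normrN ler_norm.
case=> -[z1 z2]; case=> -[w1 w2].
- by right; apply/far2/abs_ge; left; lra.
- by left; apply/far1/abs_ge; left; lra.
- by left; apply/far1/abs_ge; right; lra.
- by right; apply/far2/abs_ge; right; lra.
Qed.

Let wedgeP s (x : E) : wedge r c i0 s x ->
  0 < s * (x ord0 i0 - c ord0 i0) /\ r / 2 <= s * (x ord0 i1 - c ord0 i1).
Proof. by move=> xW; split; [have [/andP[]] := xW i0|apply: (proj2 (xW i1))]. Qed.

Let target_coord0 s : target s ord0 i0 - yc ord0 i0 = s * b.
Proof. by rewrite target_coord eqxx mul1r addrAC subrr add0r. Qed.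

Lemma plan0_aligned : \forall z \ae plan 0, aligned 1 z.
Proof.
apply: ae_law; first exact: measurable_aligned.
apply: ae_mono rho_wedge => x [] /wedgeP; rewrite ?mul1r ?mulN1r => -[v0 hx].
  left; split=> //=; rewrite /transport.
  have [[_ ->]|[nsw _]] := sideP 0 (x ord0 i0 - c ord0 i0).
    by rewrite target_coord0 !mul1r.
  by exfalso; apply: nsw; left.
right; split=> //=; rewrite /transport.
have [[sw _]|[_ ->]] := sideP 0 (x ord0 i0 - c ord0 i0); last first.
  by rewrite target_coord0 mul1r mulN1r opprK.
by move: sw v0 => [|[]]; rewrite ?oppr0; lra.
Qed.

Lemma plan_misaligned u : 0 <= u <= 1 ->
  (u%:E <= plan (width u) (aligned (-1)))%E.
Proof.
move=> u01; rewrite -(rho_strip u01).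
rewrite -[leRHS]/(rho
  ((fun x => (x, transport (width u) x)) @^-1` aligned (-1))).
apply: ae_measure_le.
- exact: mstrip.
- rewrite -[X in measurable X]setTI.
  exact: (measurable_fun_pair (@measurable_id _ E setT)
    (measurable_transport _)).
apply: ae_mono rho_wedge => x xW; rewrite /strip/= ler_norml => /andP[v1 v2].
have w0 := width_ge0 u.
case: xW => /wedgeP; rewrite ?mul1r ?mulN1r => -[v0 hx].
  left; split=> //=; rewrite /transport.
  have [[sw _]|[_ ->]] := sideP (width u) (x ord0 i0 - c ord0 i0).
    by exfalso; case: sw => [|[]]; lra.
  by rewrite target_coord0 !mulN1r opprK.
right; split=> //=; rewrite /transport.
have [[_ ->]|[nsw _]] := sideP (width u) (x ord0 i0 - c ord0 i0).
  by rewrite target_coord0 mul1r mulN1r opprK.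
by exfalso; apply: nsw; right; split=> //; lra.
Qed.

(** By uniqueness of the optimal plan: the two plans differ on
[aligned (-1)]. *)
Lemma correlation_gap_gt0 u : 0 < u <= 1 ->
  0 < correlation (plan 0) - correlation (plan (width u)).
Proof.
move=> /andP[u0 u1]; have u01 : 0 <= u <= 1 by rewrite (ltW u0).
have [gle geq] := correlation_le (plan_coupling u01).
rewrite subr_gt0 lt_neqAle gle andbT.
apply/eqP => /geq /(_ _ (measurable_aligned (-1))).
have -> : plan 0 (aligned (-1)) = 0%E.
  apply/eqP; rewrite eq_le measure_ge0 andbT -(measure0 (plan 0)).
  apply: ae_measure_le => //; apply: ae_mono plan0_aligned => z az bz.
  have := separation_gt0; have := aligned_sep az bz.
  by rewrite !subrr !enorm0 => -[|] h; rewrite ltNge h.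
by move=> h; have := plan_misaligned u01; rewrite h lee_fin leNgt u0.
Qed.

Lemma plan_distance u q : 0 <= u <= 1 -> 1 <= q ->
  ((separation * u `^ q^-1)%:E <= plan_wasserstein q (plan 0) (plan (width u)))%E.
Proof.
move=> u01 q1; have q0 : 0 < q by rewrite (lt_le_trans ltr01).
have u0 : 0 <= u by case/andP : u01.
have d0 := separation_gt0.
apply: (le_trans _ (@plan_wasserstein_ge _ _ _ _ (aligned 1) _ _ _ q1 (ltW d0)
  (measurable_aligned (-1)) plan0_aligned aligned_sep)).
have -> : (separation * u `^ q^-1)%:E = (((separation `^ q)%:E * u%:E) `^ q^-1)%E.
  rewrite -EFinM poweR_EFin powRM ?powR_ge0// -powRrM divff ?gt_eqF//.
  by rewrite powRr1// ltW.
apply: gt0_ler_poweR; rewrite ?in_itv/= ?leey ?andbT.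
- by rewrite invr_ge0 ltW.
- by rewrite mule_ge0// lee_fin ?powR_ge0.
- by rewrite mule_ge0// lee_fin powR_ge0.
- by rewrite lee_pmul2l ?lte_fin ?powR_gt0//; exact: plan_misaligned.
Qed.

(** The distance is at least of order [u^(1/q)] and the gap at most of order
[u^((1+theta)/theta)], so their ratio blows up as soon as [alpha] exceeds the
ratio of the exponents. *)
Lemma plan_distance_gap q alpha K :
  1 <= q -> theta / (q * (1 + theta)) < alpha ->
  \forall i \near \oo,
    ((K * (correlation (plan 0) -
           correlation (plan (width i.+1%:R^-1))) `^ alpha)%:E
     < plan_wasserstein q (plan 0) (plan (width i.+1%:R^-1)))%E.
Proof.
move=> q1 alphaE; have q0 : 0 < q by rewrite (lt_le_trans ltr01).
have t1 : 0 < 1 + theta by rewrite addr_gt0.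
have alpha0 : 0 < alpha.
  by rewrite (le_lt_trans _ alphaE)// divr_ge0 ?mulr_ge0// ltW.
pose s := alpha * (theta^-1 + 1) - q^-1.
have s0 : 0 < s.
  rewrite subr_gt0.
  have -> : q^-1 = theta / (q * (1 + theta)) * (theta^-1 + 1).
    by field; rewrite !gt_eqF.
  by rewrite ltr_pM2r// addr_gt0// invr_gt0.
pose C := 2 * b * r.
have C0 : 0 < C by rewrite !mulr_gt0.
pose m := (`|K| + 1) * C `^ alpha.
have m0 : 0 < m by rewrite mulr_gt0 ?powR_gt0// ltr_pwDr.
have d0 := separation_gt0.
have e0 : 0 < (separation / m) `^ s^-1 by rewrite powR_gt0// divr_gt0.
apply: filterS (near_infty_natSinv_lt (PosNum e0)) => i /=.
set u := i.+1%:R^-1 => ue.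
have u0 : 0 < u by rewrite invr_gt0.
have u1 : u <= 1 by rewrite invf_le1// ler1n.
have u01 : 0 <= u <= 1 by rewrite (ltW u0).
have us : u `^ s < separation / m.
  rewrite [ltRHS](_ : _ = ((separation / m) `^ s^-1) `^ s).
    by apply: gt0_ltr_powR; rewrite ?nnegrE ?(ltW u0) ?(ltW e0).
  by rewrite -powRrM mulVf ?gt_eqF// powRr1// divr_ge0// ltW.
apply: (lt_le_trans _ (plan_distance u01 q1)); rewrite lte_fin.
have gap0 : 0 <= correlation (plan 0) - correlation (plan (width u)).
  by rewrite ltW// correlation_gap_gt0// u0.
have gap_le : (correlation (plan 0) - correlation (plan (width u))) `^ alpha <=
    C `^ alpha * (u `^ s * u `^ q^-1).
  have hle := correlation_gap_le u01.
  have CuE : 2 * b * width u * u = C * u `^ (theta^-1 + 1).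
    rewrite powRD; last by rewrite (gt_eqF u0) implybT.
    by rewrite powRr1 ?(ltW u0)// /C /width; ring.
  have Cu0 : 0 <= C * u `^ (theta^-1 + 1) by rewrite mulr_ge0 ?powR_ge0 ?(ltW C0).
  rewrite CuE in hle.
  apply: (@le_trans _ _ ((C * u `^ (theta^-1 + 1)) `^ alpha)).
    by apply: ge0_ler_powR; rewrite ?nnegrE ?(ltW alpha0).
  rewrite powRM ?powR_ge0 ?(ltW C0)// -powRrM -powRD; last first.
    by rewrite (gt_eqF u0) implybT.
  by rewrite /s subrK [alpha * _]mulrC.
have uq0 : 0 < u `^ q^-1 by rewrite powR_gt0.
have us0 : 0 <= u `^ s by exact: powR_ge0.
have KC : K * C `^ alpha <= m.
  by rewrite ler_wpM2r ?powR_ge0// (le_trans (ler_norm _))// lerDl.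
rewrite (le_lt_trans (y := `|K| * (C `^ alpha * (u `^ s * u `^ q^-1))))//.
  rewrite (le_trans (y := `|K| *
      (correlation (plan 0) - correlation (plan (width u))) `^ alpha))//.
    by rewrite ler_wpM2r ?powR_ge0// ler_norm.
  by rewrite ler_wpM2l.
rewrite !mulrA ltr_pM2r// (le_lt_trans (y := m * u `^ s))//.
  by rewrite ler_wpM2r// ler_wpM2r ?powR_ge0// lerDl.
by rewrite mulrC -ltr_pdivlMr.
Qed.

End swap.

(** * Sharpness *)

Lemma interior_box {R : realType} {d : nat} (X : set 'rV[R]_d) : X° !=set0 ->
  exists (c : 'rV[R]_d) (r : R), 0 < r /\
    forall x : 'rV[R]_d, (forall i, `|x ord0 i - c ord0 i| <= r) -> X x.
Proof.
move=> [c /nbhs_ballP[e /= e0 eX]]; exists c, (e / 2); split.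
  by rewrite divr_gt0.
move=> x xc; apply: eX; split=> // i j; rewrite (ord1 i) /ball/= distrC.
by rewrite (le_lt_trans (xc j))// ltr_pdivrMr// ltr_pMr// ltr1n.
Qed.

(** The plans share their marginals, so that the right-hand sides of both
estimates reduce to a power of the gap: the excess of quadratic cost is twice the
gap. The distance then exceeds this power times any constant [K]. *)
Lemma exists_swap_family {R : realType} {d : nat} (theta : R)
    (X Y : set 'rV[R]_d)
    (d_ge2 : (2 <= d)%N) (theta_gt0 : 0 < theta) (theta_le1 : theta <= 1)
    (cptX : compact X) (intX : X° !=set0) (cptY : compact Y) (intY : Y° !=set0) :
  exists (rho mu : probability (borelRd R d) R)
      (gopt : probability (borelRd R d * borelRd R d)%type R)
      (g : nat -> probability (borelRd R d * borelRd R d)%type R),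
    [/\ prob_on X rho /\ prob_on Y mu,
    exists M : R, 0 < M /\ ball_condition theta M rho,
    unique_optimal_plan rho mu gopt,
    forall i, coupling rho mu (g i) /\
      0 < correlation gopt - correlation (g i) /\
      (quadratic_cost (g i) - quadratic_cost gopt =
        (2 * (correlation gopt - correlation (g i)))%:E)%E &
    forall q alpha K : R, 1 <= q -> theta / (q * (1 + theta)) < alpha ->
      \forall i \near \oo,
        ((K * (correlation gopt - correlation (g i)) `^ alpha)%:E
          < plan_wasserstein q gopt (g i))%E].
Proof.
have [c [r [r0 rX]]] := interior_box intX.
have [yc [b [b0 bY]]] := interior_box intY.
pose i0 : 'I_d := Ordinal (ltnW d_ge2).
pose i1 : 'I_d := Ordinal d_ge2.
have i10 : i1 != i0 by [].
have [rho [[mW rW] ball su]] := exists_source c i0 theta_gt0 theta_le1 r0.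
have rho_wedge := ae_full mW rW.
have rho_switch u (u01 : 0 <= u <= 1) :
    rho [set x | switch (width theta r u) (x ord0 i0 - c ord0 i0)] = (2^-1)%:E.
  exact: proj1 (su u u01).
have rho_strip u (u01 : 0 <= u <= 1) :
    rho (strip c i0 (width theta r u)) = u%:E.
  exact: proj2 (su u u01).
pose mu := image_measure b c yc i0 rho.
pose pl (t : R) := plan b c yc i0 rho t.
have u01 i : 0 < i.+1%:R^-1 :> R /\ i.+1%:R^-1 <= 1 :> R.
  by rewrite invr_gt0 invf_le1// ler1n ltr0n.
exists rho, mu, (pl 0), (fun i => pl (width theta r i.+1%:R^-1)).
have cplP i : coupling rho mu (pl (width theta r i.+1%:R^-1)).
  have [u0 u1] := u01 i.
  by apply: (plan_coupling b yc theta_gt0 rho_switch); rewrite (ltW u0).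
have opt := plan0_optimal yc theta_gt0 r0 b0 rho_wedge rho_switch.
have cpl0 : coupling rho mu (pl 0) by case: opt => -[].
split=> //.
- split; apply/eqP; rewrite eq_le probability_le1/=.
  + rewrite -rW; apply: le_measure; rewrite ?inE//.
      exact: compact_measurable_Rd.
    have wX s : `|s| = 1 -> wedge r c i0 s `<=` X.
      move=> s1 x xW; apply: rX => i; have [/andP[h0 hr] _] := xW i.
      by rewrite -[leLHS]mul1r -s1 -normrM ger0_norm// ltW.
    by move=> x [|]; apply: wX; rewrite ?normr1 ?normrN1.
  + exact: compact_measurable_Rd.
  + have tY s : `|s| = 1 -> Y (target b yc i0 s).
      move=> s1; apply: bY => i; rewrite target_coord addrAC subrr add0r.
      rewrite !normrM s1 mul1r (gtr0_norm b0) normr_nat ler_piMl ?(ltW b0)//.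
      by rewrite lern1 leq_b1.
    rewrite -(probability_setT mu); apply: ae_measure_le => //.
      exact: compact_measurable_Rd.
    apply: ae_mono (image_measure_support b c yc i0 rho) => y yT _.
    by case: yT => ->; apply: tY; rewrite ?normr1 ?normrN1.
  + exact: compact_measurable_Rd.
- move=> i; have [u0 u1] := u01 i; split; first exact: cplP.
  have [k costE] := quadratic_cost_gap yc r0 b0 rho_wedge.
  split.
    apply: (correlation_gap_gt0 yc theta_gt0 r0 b0 i10 rho_wedge rho_switch
      rho_strip).
    by rewrite u0.
  by rewrite !costE// -EFinB; congr (_%:E); ring.
- move=> q alpha K q1 alphaE.
  exact: (plan_distance_gap yc theta_gt0 r0 b0 i10 rho_wedge rho_switch
    rho_strip K q1 alphaE).
Qed.

Theorem proposition5p3 (R : realType) (d : nat) (theta : R)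
    (X Y : set 'rV[R]_d)
    (d_ge2 : (2 <= d)%N) (theta_gt0 : 0 < theta) (theta_le1 : theta <= 1)
    (cptX : compact X) (cvxX : convex_set X) (intX : X° !=set0)
    (cptY : compact Y) (cvxY : convex_set Y) (intY : Y° !=set0) :
  (exists (rho mu : probability (borelRd R d) R)
      (gopt : probability (borelRd R d * borelRd R d)%type R)
      (g : nat -> probability (borelRd R d * borelRd R d)%type R),
    prob_on X rho /\
    (exists M : R, 0 < M /\ ball_condition theta M rho) /\
    prob_on Y mu /\
    unique_optimal_plan rho mu gopt /\
    (forall i, coupling rho mu (g i)) /\
    (forall q alpha : R, 1 <= q -> theta / (q * (1 + theta)) < alpha ->
      limn_esup (fun i =>
        plan_wasserstein q gopt (g i) *
        ((correlation gopt - correlation (g i)) `^ alpha)^-1%:E)%E = +oo%E))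
  /\
  (forall q alpha : R, 1 <= q -> theta / (q * (1 + theta)) < alpha ->
    ~ estimate_varying_marginals theta X Y q alpha)
  /\
  (forall (q : R) (r : \bar R) (alpha : R),
    1 <= q -> (1 <= r)%E -> theta / (q * (1 + theta)) < alpha ->
    ~ estimate_reference_measure theta X Y q r alpha).
Proof.
have [rho [mu [gopt [g [[rhoX muY] [M [M0 ball]] opt gP blowup]]]]] :=
  exists_swap_family d_ge2 theta_gt0 theta_le1 cptX intX cptY intY.
split; [|split].
- exists rho, mu, gopt, g; split=> //; split; first by exists M.
  split=> //; split=> //; split=> [i|q alpha q1 alphaE]; first by case: (gP i).
  apply: (cvg_limn_einf_sup _).2; apply/cvgeyPge => K.
  apply: filterS (blowup q alpha K q1 alphaE) => i Kw.
  have [_ [gap0 _]] := gP i.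
  have gapa0 : 0 < (correlation gopt - correlation (g i)) `^ alpha.
    exact: powR_gt0.
  rewrite -[leLHS](_ : (K * (correlation gopt - correlation (g i)) `^ alpha)%:E *
      ((correlation gopt - correlation (g i)) `^ alpha)^-1%:E = K%:E)%E; last first.
    by rewrite -EFinM mulfK// gt_eqF.
  by rewrite lee_pmul2r ?lte_fin ?invr_gt0// ltW.
- move=> q alpha q1 alphaE est.
  have [C Cest] := est M rho mu gopt M0 rhoX ball muY opt.1.
  have [i _ /(_ i (leqnn i))/=] := blowup q alpha C q1 alphaE.
  have [giP [gap0 _]] := gP i; apply/negP; rewrite -leNgt.
  have := Cest rho mu (g i) rhoX muY giP.
  rewrite !wasserstein_self// !mule0 !adde0 gtr0_norm//.
- move=> q r alpha q1 r1 alphaE est.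
  have [C0 [C1 Cest]] := est M rho M0 rhoX ball.
  (* the excess of quadratic cost is twice the loss of correlation *)
  have [i _ /(_ i (leqnn i))/=] := blowup q alpha (C0 * 2 `^ alpha) q1 alphaE.
  have [giP [gap0 costE]] := gP i; apply/negP; rewrite -leNgt.
  have := Cest rho mu gopt (g i) rhoX muY opt.1 giP.
  have nu0 : nu theta q r != 0.
    rewrite gt_eqF// /nu; case: r r1 {Cest est} => [s|_|//]; last first.
      by rewrite divr_gt0// (lt_le_trans ltr01).
    rewrite lee_fin => s1; have s0 := lt_le_trans ltr01 s1.
    by rewrite divr_gt0 ?mulr_gt0 ?addr_gt0// (lt_le_trans ltr01).
  rewrite wasserstein_self// poweR0r// mule0 adde0.
  rewrite (wasserstein2_optimal opt.1) costE.
  by rewrite poweR_EFin -EFinM powRM// ?(ltW gap0)// mulrA.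
Qed.
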